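(* Let $G$ be a discrete group and let $B$ be a unital C$^*$-algebra. Suppose that $\psi:G\to\operatorname{Pic}(B)$ is a group homomorphism such that $\operatorname{Ext}(G,B,\psi)\neq\emptyset$. Then the map $$H^2(G,UZ(B))_\psi\times\operatorname{Ext}(G,B,\psi)\to\operatorname{Ext}(G,B,\psi),\qquad\big([\omega],[\mathcal{B}((B_g,\Psi_{g,h})_{g,h\in G})]\big)\mapsto[\mathcal{B}((B_g,\omega\Psi_{g,h})_{g,h\in G})]$$ is a well-defined simply transitive action. Here $(\omega\Psi)_{g,h}:=\omega(g,h)\Psi_{g,h}$, i.e. $\Psi_{g,h}$ followed by left multiplication by $\omega(g,h)$ on $B_{gh}$.
   Context: A Morita equivalence $B$-bimodule is a $B$-$B$ imprimitivity bimodule; isomorphisms are $B$-bimodule isomorphisms preserving both inner products. $\operatorname{Pic}(B)$ is the group of isomorphism classes $[M]$ of Morita equivalence $B$-bimodules under $\otimes_B$. $UZ(B)$ is the group of unitaries of the center of $B$. Module structure: for a Morita equivalence $B$-bimodule $M$ and $u\in UZ(B)$ let $\psi_M(u)\in UZ(B)$ be the unique element with $\psi_M(u)m=mu$ for all $m\in M$. The map $\mu:\operatorname{Pic}(B)\to\operatorname{Aut}(UZ(B))$, $[M]\mapsto\psi_M$, is a group homomorphism, and $UZ(B)$ is a $G$-module via $\mu\circ\psi$. $H^p(G,UZ(B))_\psi$, with cocycles $Z^p(G,UZ(B))_\psi$ and coboundaries $B^p(G,UZ(B))_\psi$, is group cohomology for this $G$-module, computed with normalized cochains (maps $G^p\to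 UZ(B)$ equal to $1_B$ whenever one argument is $e$). A (discrete) Fell bundle $(\mathcal{B},G,\pi)$ over the discrete group $G$ is a set $\mathcal{B}$ with a surjection $\pi:\mathcal{B}\to G$ whose fibers $B_g=\pi^{-1}(g)$ are complex Banach spaces, with an associative multiplication and an involution such that: $B_gB_h\subseteq B_{gh}$, bilinearly; $\|st\|\le\|s\|\|t\|$; $B_g^*\subseteq B_{g^{-1}}$, antilinearly; $(st)^*=t^*s^*$; $(s^* )^*=s$; $\|s^*s\|=\|s\|^2$; $s^*s\ge0$ in the C$^*$-algebra $B_e$ (the unit fiber). It is saturated if $\operatorname{span}\{B_gB_h\}$ is dense in $B_{gh}$ for all $g,h$. A saturated Fell bundle with unit fiber $B$ has fibers that are Morita equivalence $B$-bimodules (with ${}_B\langle s,t\rangle=st^*$, $\langle s,t\rangle_B=s^*t$), and its Picard homomorphism is $\psi_{\mathcal{B}}:G\to\operatorname{Pic}(B)$, $g\mapsto[B_g]$. Two saturated Fell bundles $\mathcal{B}^1,\mathcal{B}^2$ over $G$ with unit fiber $B$ are equivalent if there is a bijection $\Psi:\mathcal{B}^1\to\mathcal{B}^2$ restricting to linear isometries $\Psi_g:B^1_g\to B^2_g$ with $\Psi_e=\operatorname{id}_B$, $\Psi_g(s)\Psi_h(t)=\Psi_{gh}(st)$ and $\Psi_g(s)^*=\Psi_{g^{-1}}(s^* )$. $\operatorname{Ext}(G,B,\psi)$ is the set of equivalence classes of saturated Fell bundles over $G$ with unit fiber $B$ and $\psi_{\mathcal{B}}=\psi$. A factor system for $\psi$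 is a family $(B_g,\Psi_{g,h})_{g,h\in G}$, where each $B_g$ represents $\psi(g)$, $B_e:=B$, and $\Psi_{g,h}:B_g\otimes_BB_h\to B_{gh}$ are isomorphisms of Morita equivalence $B$-bimodules, $\Psi_{e,e}=\operatorname{id}_B$, with $\Psi_{gh,k}\circ(\Psi_{g,h}\otimes\operatorname{id}_k)=\Psi_{g,hk}\circ(\operatorname{id}_g\otimes\Psi_{h,k})$. $\mathcal{B}((B_g,\Psi_{g,h})_{g,h\in G})$ denotes the saturated Fell bundle $\bigcup_gB_g$ with multiplication $st=\Psi_{g,h}(s\otimes t)$ ($s\in B_g$, $t\in B_h$) and involution $s^*=\lambda_s^*(1_B)$ ($s\in B_g$), where $\lambda_s:B_{g^{-1}}\to B$, $\lambda_s(t)=\Psi_{g,g^{-1}}(s\otimes t)$, and $\lambda_s^*$ is its adjoint. A representative $B_g$ of each $\psi(g)$, with $B_e=B$, is fixed; each class in $\operatorname{Ext}(G,B,\psi)$ is represented by a bundle $\mathcal{B}((B_g,\Psi_{g,h})_{g,h\in G})$ with these $B_g$. *)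

(* Defs.v *)
(* The complex numbers are R[i] for R : realType, and a complex Banach space is
   a completeNormedModType R[i], whose norm takes its values in R[i]. *)
From HB Require Import structures.
From mathcomp Require Import all_boot all_order all_algebra.
From mathcomp Require Import complex.
From mathcomp Require Import all_classical all_reals all_analysis.

Set Implicit Arguments.
Unset Strict Implicit.
Unset Printing Implicit Defensive.

Import Order.TTheory GRing.Theory Num.Theory numFieldNormedType.Exports.

Local Open Scope classical_set_scope.
Local Open Scope ring_scope.

Reserved Notation "a ** b" (at level 40, left associativity).

(* Unital C*-algebras; the zero algebra is allowed. The multiplication is part
   of this structure because MathComp's hierarchy does not allow a structure to
   inherit both from its rings and from its normed modules. *)
HB.mixin Record isCStarAlgebra (R : realType) A of CompleteNormedModule R[i] A := {
  cmul : A -> A -> A;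
  cone : A;
  cstar : A -> A;
  cmulA : forall a b c : A, cmul a (cmul b c) = cmul (cmul a b) c;
  cmul1l : forall a : A, cmul cone a = a;
  cmul1r : forall a : A, cmul a cone = a;
  cmul_linearl : forall (z : R[i]) (a b c : A),
    cmul (z *: a + b) c = z *: cmul a c + cmul b c;
  cmul_linearr : forall (z : R[i]) (a b c : A),
    cmul a (z *: b + c) = z *: cmul a b + cmul a c;
  cnormM : forall a b : A, `|cmul a b| <= `|a| * `|b|;
  cstar_antilinear : forall (z : R[i]) (a b : A),
    cstar (z *: a + b) = Num.conj z *: cstar a + cstar b;
  cstarM : forall a b : A, cstar (cmul a b) = cmul (cstar b) (cstar a);
  cstarK : forall a : A, cstar (cstar a) = a;
  cnorm_star : forall a : A, `|cmul (cstar a) a| = `|a| ^+ 2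
}.

#[short(type="cstarAlgType")]
HB.structure Definition CStarAlgebra (R : realType) :=
  {A of isCStarAlgebra R A & CompleteNormedModule R[i] A}.

Notation "a ** b" := (cmul a b) : ring_scope.

Section CStar.
Context {R : realType} {B : cstarAlgType R}.

Definition cinvertible (a : B) : Prop := exists b : B, a ** b = cone /\ b ** a = cone.

Definition spectrum (a : B) : set R[i] :=
  [set z | ~ cinvertible (a - z *: cone)].

(* In the order of R[i], 0 <= z says that z is real and nonnegative. *)
Definition cpositive (a : B) : Prop :=
  cstar a = a /\ spectrum a `<=` [set z | 0 <= z].

Definition UZ : set B :=
  [set u | [/\ cstar u ** u = cone, u ** cstar u = cone & forall a, u ** a = a ** u]].

End CStar.
Arguments UZ {R} B.

Section Linear.
Context {R : realType}.

Definition is_linear (U V : lmodType R[i]) (f : U -> V) : Prop :=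
  forall (z : R[i]) x y, f (z *: x + y) = z *: f x + f y.

Definition is_antilinear (U V : lmodType R[i]) (f : U -> V) : Prop :=
  forall (z : R[i]) x y, f (z *: x + y) = Num.conj z *: f x + f y.

Definition is_bilinear (U V W : lmodType R[i]) (f : U -> V -> W) : Prop :=
  (forall y, is_linear (fun x => f x y)) /\ (forall x, is_linear (f x)).

Definition lin_span (V : lmodType R[i]) (S : set V) : set V :=
  [set x | exists n (c : 'I_n -> R[i]) (s : 'I_n -> V),
     (forall i, S (s i)) /\ x = \sum_(i < n) c i *: s i].

End Linear.

Section Bimodules.
Context {R : realType} {B : cstarAlgType R}.

(* Operations only; the axioms are in [is_morita]. The left inner product is
   linear in its first variable, the right one in its second. *)
Record bimod := Bimod {
  bcar :> completeNormedModType R[i];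
  lact : B -> bcar -> bcar;
  ract : bcar -> B -> bcar;
  linner : bcar -> bcar -> B;
  rinner : bcar -> bcar -> B
}.

(* B-B imprimitivity bimodules. The norms defined by the two inner products of
   an imprimitivity bimodule coincide; they are the norm of the carrier. *)
Record is_morita (X : bimod) : Prop := {
  lact_bilinear : is_bilinear (@lact X);
  lact1 : forall x : X, lact cone x = x;
  lactM : forall a b (x : X), lact (a ** b) x = lact a (lact b x);
  ract_bilinear : is_bilinear (@ract X);
  ract1 : forall x : X, ract x cone = x;
  ractM : forall (x : X) a b, ract x (a ** b) = ract (ract x a) b;
  lractA : forall a (x : X) b, ract (lact a x) b = lact a (ract x b);
  linner_linear : forall y : X, is_linear (fun x => linner x y);
  linner_star : forall x y : X, cstar (linner x y) = linner y x;
  linner_lact : forall a (x y : X), linner (lact a x) y = a ** linner x y;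
  linner_pos : forall x : X, cpositive (linner x x);
  linner_norm : forall x : X, `|linner x x| = `|x| ^+ 2;
  linner_full : dense (lin_span [set b | exists x y : X, b = linner x y]);
  rinner_linear : forall x : X, is_linear (rinner x);
  rinner_star : forall x y : X, cstar (rinner x y) = rinner y x;
  rinner_ract : forall (x y : X) b, rinner x (ract y b) = rinner x y ** b;
  rinner_pos : forall x : X, cpositive (rinner x x);
  rinner_norm : forall x : X, `|rinner x x| = `|x| ^+ 2;
  rinner_full : dense (lin_span [set b | exists x y : X, b = rinner x y]);
  rinner_lact : forall a (x y : X), rinner (lact a x) y = rinner x (lact (cstar a) y);
  linner_ract : forall (x y : X) b, linner (ract x b) y = linner x (ract y (cstar b));
  linner_rinner : forall x y z : X, lact (linner x y) z = ract x (rinner y z)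
}.

Record is_morita_iso (X Y : bimod) (f : X -> Y) : Prop := {
  miso_bij : bijective f;
  miso_linear : is_linear f;
  miso_lact : forall a x, f (lact a x) = lact a (f x);
  miso_ract : forall x a, f (ract x a) = ract (f x) a;
  miso_linner : forall x y, linner (f x) (f y) = linner x y;
  miso_rinner : forall x y, rinner (f x) (f y) = rinner x y
}.

(* A model of the internal tensor product X (x)_B Y: a completion of the
   algebraic balanced tensor product for the usual inner products. *)
Record tensorProduct (X Y : bimod) := TensorProduct {
  tcar :> bimod;
  tens : X -> Y -> tcar;
  tens_morita : is_morita tcar;
  tens_bilinear : is_bilinear tens;
  tens_balanced : forall x b y, tens (ract x b) y = tens x (lact b y);
  tens_lact : forall a x y, lact a (tens x y) = tens (lact a x) y;
  tens_ract : forall x y a, ract (tens x y) a = tens x (ract y a);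
  tens_linner : forall x y x' y',
    linner (tens x y) (tens x' y') = linner (ract x (linner y y')) x';
  tens_rinner : forall x y x' y',
    rinner (tens x y) (tens x' y') = rinner y (lact (rinner x x') y');
  tens_dense : dense (lin_span [set t | exists x y, t = tens x y])
}.

(* Isomorphism classes are predicates because [bimod] does not fit in the
   universe of [set]. *)
Definition pic_class (X : bimod) : bimod -> Prop :=
  fun Y => is_morita Y /\ exists f : X -> Y, is_morita_iso f.

Definition Pic (p : bimod -> Prop) : Prop :=
  exists X, is_morita X /\ p = pic_class X.

(* [X][Y] is the class of X (x)_B Y; it does not depend on the representatives
   nor on the model of the tensor product. *)
Definition pic_mul (p q : bimod -> Prop) : bimod -> Prop :=
  fun Z => exists (X Y : bimod) (T : tensorProduct X Y),
    [/\ p X, q Y & pic_class T Z].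

(* psi_M(u) for p = [M]: the unique v in UZ(B) with v m = m u for all m. *)
Definition pic_act (p : bimod -> Prop) (u : B) : B :=
  xget cone [set v | UZ B v /\ forall X : bimod, p X -> forall m : X, lact v m = ract m u].

(* The adjoint f^* at y, characterised by <f x, y>_B = <x, f^* y>_B. *)
Definition adjoint (X Y : bimod) (f : X -> Y) (y : Y) : X :=
  xget 0 [set z | forall x, rinner (f x) y = rinner x z].

End Bimodules.
Arguments bimod {R} B.
Arguments Pic {R} B.

Definition regular {R : realType} (B : cstarAlgType R) : bimod B :=
  @Bimod R B B (@cmul R B) (@cmul R B)
    (fun a b => a ** cstar b) (fun a b => cstar a ** b).

(* Transport between the fibres over two equal group elements, for fibres in a
   type V of structures with carriers T. *)
Definition recast {G V : Type} (F : G -> V) (T : V -> Type) (g h : G)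
    (e : g = h) (x : T (F g)) : T (F h) :=
  ecast k (T (F k)) e x.

Section FellBundles.
Context {R : realType} {G : groupType} {B : cstarAlgType R}.

(* The total space is the disjoint union of the fibres [fib g]. The unit fibre
   is identified with B through [funit]. Operations only; the axioms are in
   [is_fell]. *)
Record fell := Fell {
  fib : G -> completeNormedModType R[i];
  fmul : forall g h, fib g -> fib h -> fib (g * h)%g;
  fstar : forall g, fib g -> fib (g^-1)%g;
  funit : B -> fib 1%g
}.

Definition fcast (E : fell) (g h : G) (e : g = h) (s : fib E g) : fib E h :=
  recast (T := fun V : completeNormedModType R[i] => V) e s.

Definition funit_inv (E : fell) (s : fib E 1%g) : B :=
  xget 0 [set b | funit E b = s].

(* The fibre over g with its B-bimodule structure: a.s and s.a are products in
   the bundle, and the inner products are s t^* and s^* t. *)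
Definition fell_bimod (E : fell) (g : G) : bimod B :=
  @Bimod R B (fib E g)
    (fun a s => fcast (mul1g g) (fmul (funit E a) s))
    (fun s a => fcast (mulg1 g) (fmul s (funit E a)))
    (fun s t => funit_inv (fcast (mulgV g) (fmul s (fstar t))))
    (fun s t => funit_inv (fcast (mulVg g) (fmul (fstar s) t))).

Record is_fell (E : fell) : Prop := {
  fmul_bilinear : forall g h, is_bilinear (@fmul E g h);
  fmulA : forall g h k (s : fib E g) (t : fib E h) (u : fib E k),
    fcast (mulgA g h k) (fmul s (fmul t u)) = fmul (fmul s t) u;
  fmul_norm : forall g h (s : fib E g) (t : fib E h),
    `|fmul s t| <= `|s| * `|t|;
  fstar_antilinear : forall g, is_antilinear (@fstar E g);
  fstarM : forall g h (s : fib E g) (t : fib E h),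
    fcast (invgM g h) (fstar (fmul s t)) = fmul (fstar t) (fstar s);
  fstarK : forall g (s : fib E g), fcast (invgK g) (fstar (fstar s)) = s;
  fnorm_star : forall g (s : fib E g), `|fmul (fstar s) s| = `|s| ^+ 2;
  fell_pos : forall g (s : fib E g),
    cpositive (funit_inv (fcast (mulVg g) (fmul (fstar s) s)));
  funit_bij : bijective (funit E);
  funit_linear : is_linear (funit E);
  funit_norm : forall b, `|funit E b| = `|b|;
  funitM : forall a b,
    fcast (mulg1 1%g) (fmul (funit E a) (funit E b)) = funit E (a ** b);
  funit_star : forall a, fcast (invg1 G) (fstar (funit E a)) = funit E (cstar a)
}.

Definition saturated (E : fell) : Prop :=
  forall g h,
    dense (lin_span [set r | exists (s : fib E g) (t : fib E h), r = fmul s t]).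

Definition picard (E : fell) (g : G) : bimod B -> Prop := pic_class (fell_bimod E g).

Definition fell_equiv (E F : fell) : Prop :=
  exists f : forall g, fib E g -> fib F g,
    [/\ forall g, [/\ bijective (f g), is_linear (f g) & forall s, `|f g s| = `|s|],
        forall b, f _ (funit E b) = funit F b,
        forall g h (s : fib E g) (t : fib E h), fmul (f _ s) (f _ t) = f _ (fmul s t) &
        forall g (s : fib E g), fstar (f _ s) = f _ (fstar s)].

Definition is_picard_hom (psi : G -> bimod B -> Prop) : Prop :=
  (forall g, Pic B (psi g)) /\
  (forall g h, psi (g * h)%g = pic_mul (psi g) (psi h)).

Variable psi : G -> bimod B -> Prop.

Definition fell_over (E : fell) : Prop :=
  [/\ is_fell E, saturated E & forall g, picard E g = psi g].

Definition fell_class (E : fell) : fell -> Prop :=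
  fun F => fell_over F /\ fell_equiv E F.

Definition Ext (e : fell -> Prop) : Prop :=
  exists E, fell_over E /\ e = fell_class E.

(* Normalized cochains with values in UZ(B), on which g acts by [pic_act (psi g)]. *)
Definition C1 : set (G -> B) :=
  [set eta | (forall g, UZ B (eta g)) /\ eta 1%g = cone].

Definition C2 : set (G -> G -> B) :=
  [set w | [/\ forall g h, UZ B (w g h), forall h, w 1%g h = cone
             & forall g, w g 1%g = cone]].

Definition Z2 : set (G -> G -> B) :=
  [set w | C2 w /\ forall g h k,
     pic_act (psi g) (w h k) ** w g (h * k)%g = w (g * h)%g k ** w g h].

Definition d1 (eta : G -> B) : G -> G -> B :=
  fun g h => pic_act (psi g) (eta h) ** cstar (eta (g * h)%g) ** eta g.

Definition B2 : set (G -> G -> B) := [set d1 eta | eta in C1].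

Definition coch_mul (w v : G -> G -> B) : G -> G -> B := fun g h => w g h ** v g h.

(* H^2 = Z^2 / B^2 as the set of cosets, multiplied as subsets of Z^2. *)
Definition H2_class (w : G -> G -> B) : set (G -> G -> B) :=
  [set coch_mul b w | b in B2].

Definition H2 : set (set (G -> G -> B)) := [set H2_class w | w in Z2].

Definition H2_one : set (G -> G -> B) := H2_class (fun _ _ => cone).

Definition H2_mul (x y : set (G -> G -> B)) : set (G -> G -> B) :=
  [set coch_mul w v | w in x & v in y].

(* Representatives B_g of psi(g), with B_e = B, and models of B_g (x)_B B_h. *)
Record representatives := Representatives {
  repr :> G -> bimod B;
  repr_psi : forall g, psi g (repr g);
  repr_one : regular B -> repr 1%g;
  repr_one_iso : is_morita_iso repr_one;
  repr_tens : forall g h, tensorProduct (repr g) (repr h)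
}.

Variable M : representatives.

Definition mcast (g h : G) (e : g = h) (s : M g) : M h :=
  recast (T := fun X : bimod B => X) e s.

Definition factor_data := forall g h, repr_tens M g h -> M (g * h)%g.

Definition fs_mul (Psi : factor_data) g h (s : M g) (t : M h) : M (g * h)%g :=
  Psi g h (tens (repr_tens M g h) s t).

(* [fs_one] is Psi_{e,e} = id_B, under the identifications B_e = B and
   B (x)_B B = B. [fs_assoc] is stated on elementary tensors, which span a dense
   subspace of the triple tensor product. *)
Record factor_system (Psi : factor_data) : Prop := {
  fs_iso : forall g h, is_morita_iso (Psi g h);
  fs_one : forall a b : B,
    mcast (mulg1 1%g) (fs_mul Psi (repr_one M a) (repr_one M b)) = repr_one M (a ** b);
  fs_assoc : forall g h k (s : M g) (t : M h) (u : M k),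
    mcast (mulgA g h k) (fs_mul Psi s (fs_mul Psi t u)) = fs_mul Psi (fs_mul Psi s t) u
}.

Definition fs_lambda (Psi : factor_data) g (s : M g) (t : M (g^-1)%g) : M 1%g :=
  mcast (mulgV g) (fs_mul Psi s t).

(* The involution is s |-> lambda_s^*(1_B). *)
Definition fs_bundle (Psi : factor_data) : fell :=
  @Fell (fun g => M g) (@fs_mul Psi)
    (fun g s => adjoint (fs_lambda Psi s) (repr_one M cone))
    (repr_one M).

Definition twist (w : G -> G -> B) (Psi : factor_data) : factor_data :=
  fun g h t => lact (w g h) (Psi g h t).

End FellBundles.
Arguments fell {R} G B.
Arguments factor_data {R G B psi} M.

(* Main.v *)
Require Import Defs.
From HB Require Import structures.
From mathcomp Require Import all_boot all_order all_algebra complex.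
From mathcomp Require Import all_classical all_reals all_analysis.

Set Implicit Arguments.
Unset Strict Implicit.
Unset Printing Implicit Defensive.

Import Order.TTheory GRing.Theory Num.Theory numFieldNormedType.Exports.

Local Open Scope classical_set_scope.
Local Open Scope ring_scope.

(** The group of 2-cocycles acts simply transitively on factor systems: for a
    Morita equivalence bimodule X over a unital algebra the automorphisms of X
    are exactly the left multiplications by elements of UZ(B)
    ([morita_auto_lact], [lact_morita_iso]), so two factor systems differ in each
    degree by some w(g,h) in UZ(B), and associativity of both is the cocycle
    identity ([factor_systems_twist], [twist_factor_system]). For the same reason
    an equivalence between the bundles of two twists of one factor system is
    fibrewise left multiplication by some eta(g) in UZ(B), and multiplicativity
    says that the two cocycles differ by d1 eta ([fell_equiv_twist]). Hence
    classes of bundles are permuted simply transitively by Z2 / B2, once every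
    Fell bundle is known to come from a factor system ([ExtP]).

    What makes all this algebraic is that B is unital. Fullness of the inner
    products gives an element of their span at distance less than 1 from the
    unit, hence invertible; correcting by its inverse gives finite families with
    sum_i <x_i, y_i> = 1 ([left_frame], [right_frame]). From such a frame,
    z = sum_i x_i <y_i, z> for all z, so right-linear maps X -> X are left
    multiplications, right-linear functionals on X are inner products, and every
    element of X (x)_B Y is a finite sum of elementary tensors. The algebraic
    tensor product is thus complete, and a left-linear family beta(x,y) with the
    inner products of elementary tensors induces an isomorphism on it
    ([tens_universal]).

    The involution of the bundle of a factor system is handled through
    s t = <s^*, t> in B, which characterises s^* ([fs_lambdaE]). It implies
    s t^* = <s, t> for the left inner product and s^* t = <s, t> for the right
    one, so the fibres of the bundle are the given bimodules
    ([fell_bimod_fs_iso]) and the positivity and the C*-identity of the bundle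
    are those of the bimodules. Only the inequality |s t| <= |s| |t| needs a
    genuine estimate, [norm_rinner_lact]. *)

(** * Linear maps, powers and fixed points *)

Section LinearMaps.
Context {R : realType} {U V : lmodType R[i]} {f : U -> V} (fl : is_linear f).

Lemma is_linear0 : f 0 = 0.
Proof.
have := fl 1 0 0; rewrite !scale1r addr0 => /(congr1 (fun v => v - f 0)).
by rewrite subrr addrK.
Qed.

Lemma is_linearD x y : f (x + y) = f x + f y.
Proof. by rewrite -[x in LHS]scale1r fl scale1r. Qed.

Lemma is_linearZ z x : f (z *: x) = z *: f x.
Proof. by rewrite -[z *: x]addr0 fl is_linear0 addr0. Qed.

Lemma is_linearB x y : f (x - y) = f x - f y.
Proof. by rewrite is_linearD -scaleN1r is_linearZ scaleN1r. Qed.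

Lemma is_linear_sum (I : finType) (x : I -> U) : f (\sum_i x i) = \sum_i f (x i).
Proof. exact: (big_morph f is_linearD is_linear0). Qed.

End LinearMaps.

Lemma is_linear_comp (R : realType) (U V W : lmodType R[i])
    (g : V -> W) (f : U -> V) :
  is_linear g -> is_linear f -> is_linear (fun x => g (f x)).
Proof. by move=> gl fl z x y; rewrite fl gl. Qed.

(** The norms lie in R[i], so the decay of powers is transported from R. *)
Lemma expr_lt_small (R : realType) (q e : R[i]) :
  0 <= q -> q < 1 -> 0 < e -> exists n, q ^+ n < e.
Proof.
move=> q0 q1 e0.
have /complex_realP[s sE] : q \is Num.real by rewrite ger0_real.
have /complex_realP[d dE] : e \is Num.real by rewrite gtr0_real.
move: q0 q1 e0; rewrite sE dE -[1]/((1 : R)%:C)%C -[0]/((0 : R)%:C)%C.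
rewrite !ltcR lecR => s0 s1 d0.
have /cvgrPdist_lt/(_ d d0)[N _ /(_ N (leqnn N))] : (GRing.exp s : nat -> R) @ \oo --> 0.
  by apply: cvg_expr; rewrite ger0_norm.
rewrite sub0r normrN ger0_norm ?exprn_ge0// => sN.
by exists N; rewrite -rmorphXn/= ltcR.
Qed.

(** Banach's fixed point theorem, for norms with values in R[i]. *)
Lemma contraction_fixpoint (R : realType) (X : completeNormedModType R[i])
    (q : R[i]) (f : X -> X) :
  0 <= q -> q < 1 -> (forall x y, `|f x - f y| <= q * `|x - y|) ->
  exists x, x = f x.
Proof.
move=> q0 q1 fq; pose y n := iter n f 0; pose C : R[i] := `|f 0|.
have q'0 : 0 < 1 - q by rewrite subr_gt0.
have step n : `|y n - y n.+1| <= q ^+ n * C.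
  elim: n => [|n IH]; first by rewrite expr0 mul1r sub0r normrN.
  by rewrite (le_trans (fq _ _))// exprS -mulrA ler_wpM2l.
have dist n k : (1 - q) * `|y n - y (n + k)%N| <= (q ^+ n - q ^+ (n + k)) * C.
  elim: k => [|k IH]; first by rewrite addn0 !subrr normr0 mulr0 mul0r.
  apply: le_trans (ler_wpM2l (ltW q'0) (ler_distD (y (n + k)%N) _ _)) _.
  rewrite mulrDr addnS; apply: le_trans (lerD IH (ler_wpM2l (ltW q'0) (step _))) _.
  by rewrite mulrA -mulrDl mulrBl mul1r -exprS addrA subrK.
have bound n k : `|y n - y (n + k)%N| <= q ^+ n * (C / (1 - q)).
  rewrite mulrA ler_pdivlMr// mulrC (le_trans (dist _ _))//.
  apply: ler_wpM2r; first exact: normr_ge0.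
  by rewrite lerBlDr lerDl exprn_ge0.
have C0 : 0 <= C by exact: normr_ge0.
have D0 : 0 < C / (1 - q) + 1 by rewrite ltr_pwDr// divr_ge0// ltW.
have small e : 0 < e -> exists N, forall k, `|y N - y (N + k)%N| < e.
  move=> e0; have [N qN] := expr_lt_small q0 q1 (divr_gt0 e0 D0).
  exists N => k; apply: (le_lt_trans (bound _ _)).
  move: qN; rewrite ltr_pdivlMr//; apply: le_lt_trans.
  by rewrite ler_wpM2l ?exprn_ge0// lerDl.
have cy : cauchy (y @ \oo).
  apply: cauchy_exP => e e0; have [N yN] := small e e0.
  exists (y N), N => // n /= Nn; rewrite -ball_normE /=.
  by rewrite -(subnKC Nn).
have /cvg_ex[l /cvgrPdist_lt yl] : cvg (y @ \oo) by apply/cauchy_cvgP.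
exists l; apply/eqP; rewrite -subr_eq0 -normr_eq0; apply/eqP.
apply/eqP; rewrite eq_le normr_ge0 andbT.
apply/ler_addgt0Pr => e e0; rewrite add0r.
have [N _ lN] := yl (e / 2) (divr_gt0 e0 (ltr0Sn _ 1)).
rewrite (le_trans (ler_distD (y N.+1) _ _))// [leRHS]splitr lerD//.
  by rewrite ltW// lN//=.
rewrite distrC (le_trans (fq _ _))// -[leRHS]mul1r ler_pM// ltW//.
exact: lN (leqnn N).
Qed.
(** The constant K disappears when 2^k-th roots are taken; this sharpens a crude
    norm estimate that is stable under repeated squaring. *)
Lemma le_of_expr_le (R : realType) (K x y : R[i]) :
  0 <= x -> 0 <= y -> (forall k, x ^+ (2 ^ k) <= K * y ^+ (2 ^ k)) -> x <= y.
Proof.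
move=> x0 y0 xy; rewrite real_leNgt ?ger0_real//; apply/negP => yx.
have xgt0 : 0 < x by apply: le_lt_trans yx.
have Kgt0 : 0 < K.
  rewrite lt_neqAle; have := xy 0%N; rewrite !expr1 => xKy.
  have Ky : 0 < K * y by apply: lt_le_trans xKy.
  have ygt0 : 0 < y.
    rewrite lt_neqAle y0 andbT; apply: contraTneq Ky => <-.
    by rewrite mulr0 ltxx.
  by rewrite -lt_neqAle -(pmulr_lgt0 _ ygt0).
have q0 : 0 <= y / x by rewrite divr_ge0.
have q1 : y / x < 1 by rewrite ltr_pdivrMr// mul1r.
have [n qn] := expr_lt_small q0 q1 (divr_gt0 ltr01 Kgt0).
have nn : (n <= 2 ^ n)%N by rewrite ltnW// ltn_expl.
have : (y / x) ^+ (2 ^ n) < 1 / K.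
  by apply: le_lt_trans qn; apply: ler_wiXn2l nn; last exact: ltW.
rewrite expr_div_n ltr_pdivrMr ?exprn_gt0// mul1r mulrC ltr_pdivlMr// mulrC.
by move=> /(le_lt_trans (xy n)); rewrite ltxx.
Qed.

(** * Unital C*-algebras *)

Section CStarAlgebra.
Context {R : realType} {B : cstarAlgType R}.
Implicit Types a b c u v : B.

Lemma cmul_linl c : is_linear (fun a : B => a ** c).
Proof. by move=> z a b; exact: cmul_linearl. Qed.

Lemma cmul_linr c : is_linear (fun a : B => c ** a).
Proof. by move=> z a b; exact: cmul_linearr. Qed.

Lemma cmulBl a b c : (a - b) ** c = a ** c - b ** c.
Proof. exact: (is_linearB (cmul_linl c)). Qed.

Lemma cmulBr a b c : a ** (b - c) = a ** b - a ** c.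
Proof. exact: (is_linearB (cmul_linr a)). Qed.

Lemma cmul_suml (I : finType) (a : I -> B) c : (\sum_i a i) ** c = \sum_i a i ** c.
Proof. exact: (is_linear_sum (cmul_linl c)). Qed.

Lemma cmul_sumr (I : finType) c (a : I -> B) : c ** (\sum_i a i) = \sum_i c ** a i.
Proof. exact: (is_linear_sum (cmul_linr c)). Qed.

Lemma cstar1 : cstar (cone : B) = cone.
Proof.
have /(congr1 cstar) := cmul1l (cstar (cone : B)).
by rewrite cstarM !cstarK cmul1l.
Qed.

Lemma cstarD a b : cstar (a + b) = cstar a + cstar b.
Proof. by have := cstar_antilinear 1 a b; rewrite conjC1 !scale1r. Qed.

Lemma cstar0 : cstar (0 : B) = 0.
Proof.
by apply/(addrI (cstar (0 : B))); rewrite -cstarD !addr0.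
Qed.

Lemma cstar_sum (I : finType) (a : I -> B) : cstar (\sum_i a i) = \sum_i cstar (a i).
Proof. exact: (big_morph cstar cstarD cstar0). Qed.

Lemma cstarZ z a : cstar (z *: a) = Num.conj z *: cstar a.
Proof. by rewrite -[z *: a]addr0 cstar_antilinear cstar0 addr0. Qed.

Lemma cstarB a b : cstar (a - b) = cstar a - cstar b.
Proof. by apply/eqP; rewrite eq_sym subr_eq -cstarD subrK. Qed.

Lemma cnormV a : `|cstar a| = `|a|.
Proof.
suff le b : `|b| <= `|cstar b|.
  by apply/eqP; rewrite eq_le -{2}[a]cstarK !le.
have [->|b0] := eqVneq b 0; first by rewrite cstar0.
rewrite -(ler_pM2r (x := `|b|)) ?normr_gt0// -expr2 -cnorm_star.
exact: cnormM.
Qed.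

(** A left inverse of b is a fixed point of x |-> 1 + x (1 - b). *)
Lemma left_inverse_near1 b : `|cone - b| < 1 -> exists c, c ** b = cone.
Proof.
move=> b1.
have [|x xE] := @contraction_fixpoint R B `|cone - b|
    (fun x => cone + x ** (cone - b)) (normr_ge0 _) b1.
  move=> x y; rewrite opprD addrACA subrr add0r -cmulBl mulrC.
  exact: cnormM.
exists x; apply/(addIr (x - x ** b)); rewrite addrCA subrr addr0.
by rewrite {1}xE cmulBr cmul1r.
Qed.

Lemma right_inverse_near1 b : `|cone - b| < 1 -> exists c, b ** c = cone.
Proof.
move=> b1; have [|c cb] := @left_inverse_near1 (cstar b).
  by rewrite -cstar1 -cstarB cnormV.
exists (cstar c).
by rewrite -[b]cstarK -cstarM cb cstar1.
Qed.

Lemma dense_span_near1 (S : set B) : dense (lin_span S) ->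
  exists n (z : 'I_n -> R[i]) (s : 'I_n -> B),
    (forall i, S (s i)) /\ `|cone - \sum_i z i *: s i| < 1.
Proof.
move=> dS.
have [] := dS (ball (cone : B) 1); first by exists cone; exact: ballxx.
  exact: ball_open.
move=> x [+ [n [z [s [Ss xE]]]]]; rewrite -ball_normE /= xE => lt1.
by exists n, z, s.
Qed.

Lemma UZ1 : UZ B cone.
Proof. by split => [||a]; rewrite ?cstar1 ?cmul1l ?cmul1r. Qed.

Lemma UZC u a : UZ B u -> u ** a = a ** u.
Proof. by case. Qed.

Lemma UZ_mulVl u : UZ B u -> cstar u ** u = cone.
Proof. by case. Qed.

Lemma UZ_mulVr u : UZ B u -> u ** cstar u = cone.
Proof. by case. Qed.

Lemma UZM u v : UZ B u -> UZ B v -> UZ B (u ** v).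
Proof.
move=> Uu Uv; split => [||a].
- by rewrite cstarM -cmulA (cmulA (cstar u)) (UZ_mulVl Uu) cmul1l (UZ_mulVl Uv).
- by rewrite cstarM -cmulA (cmulA v) (UZ_mulVr Uv) cmul1l (UZ_mulVr Uu).
- by rewrite -cmulA (UZC _ Uv) cmulA (UZC _ Uu) -cmulA.
Qed.

Lemma UZ_star u : UZ B u -> UZ B (cstar u).
Proof.
move=> Uu; split=> [||a]; rewrite ?cstarK ?(UZ_mulVl Uu) ?(UZ_mulVr Uu)//.
by rewrite -[a in LHS]cstarK -cstarM -(UZC _ Uu) cstarM cstarK.
Qed.

End CStarAlgebra.

(** * Morita equivalence bimodules *)

Section Morita.
Context {R : realType} {B : cstarAlgType R} {X : bimod B} (mX : is_morita X).
Implicit Types (a b : B) (x y z : X).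

Let lactl y := (lact_bilinear mX).1 y.
Let lactr a := (lact_bilinear mX).2 a.
Let ractl b := (ract_bilinear mX).1 b.
Let ractr x := (ract_bilinear mX).2 x.

Lemma lact_suml (I : finType) (a : I -> B) y :
  lact (\sum_i a i) y = \sum_i lact (a i) y.
Proof. exact: (is_linear_sum (lactl y)). Qed.

Lemma lact_sumr (I : finType) a (x : I -> X) :
  lact a (\sum_i x i) = \sum_i lact a (x i).
Proof. exact: (is_linear_sum (lactr a)). Qed.

Lemma ract_suml (I : finType) (x : I -> X) b :
  ract (\sum_i x i) b = \sum_i ract (x i) b.
Proof. exact: (is_linear_sum (ractl b)). Qed.

Lemma ract_sumr (I : finType) (b : I -> B) x :
  ract x (\sum_i b i) = \sum_i ract x (b i).
Proof. exact: (is_linear_sum (ractr x)). Qed.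

Lemma linner_suml (I : finType) (x : I -> X) y :
  linner (\sum_i x i) y = \sum_i linner (x i) y.
Proof. exact: (is_linear_sum (linner_linear mX y)). Qed.

Lemma rinner_sumr (I : finType) (x : I -> X) y :
  rinner y (\sum_i x i) = \sum_i rinner y (x i).
Proof. exact: (is_linear_sum (rinner_linear mX y)). Qed.

Lemma linner_lactr a x y : linner x (lact a y) = linner x y ** cstar a.
Proof.
by rewrite -(linner_star mX) (linner_lact mX) cstarM (linner_star mX).
Qed.

Lemma rinner_ractl b x y : rinner (ract x b) y = cstar b ** rinner x y.
Proof.
by rewrite -(rinner_star mX) (rinner_ract mX) cstarM (rinner_star mX).
Qed.

Lemma linnerDl x y z : linner (x + y) z = linner x z + linner y z.
Proof. exact: is_linearD (linner_linear mX z) _ _. Qed.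

Lemma linnerDr x y z : linner z (x + y) = linner z x + linner z y.
Proof. by rewrite -(linner_star mX) linnerDl cstarD !(linner_star mX). Qed.

Lemma rinnerDr x y z : rinner z (x + y) = rinner z x + rinner z y.
Proof. exact: is_linearD (rinner_linear mX z) _ _. Qed.

Lemma rinnerDl x y z : rinner (x + y) z = rinner x z + rinner y z.
Proof. by rewrite -(rinner_star mX) rinnerDr cstarD !(rinner_star mX). Qed.

Lemma rinnerZl k x y : rinner (k *: x) y = Num.conj k *: rinner x y.
Proof.
rewrite -(rinner_star mX) (is_linearZ (rinner_linear mX _)) cstarZ.
by rewrite (rinner_star mX).
Qed.

Lemma linner_inj x y : (forall z, linner x z = linner y z) -> x = y.
Proof.
move=> xy; apply/eqP; rewrite -subr_eq0 -normr_eq0 -sqrf_eq0.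
rewrite -(linner_norm mX) normr_eq0 (is_linearB (linner_linear mX _)) xy.
by rewrite subrr.
Qed.

(** An element of the span of the inner products near the unit has a left
    inverse, which the left linearity of the inner product absorbs. *)
Lemma left_frame : exists n (x y : 'I_n -> X), \sum_i linner (x i) (y i) = cone.
Proof.
have [n [z [s [Ss lt1]]]] := dense_span_near1 (linner_full mX).
have [c cb] := left_inverse_near1 lt1.
have [x /choice[y xy]] := choice Ss.
exists n, (fun i => lact c (z i *: x i)), y.
rewrite -cb cmul_sumr; apply: eq_bigr => i _.
by rewrite (linner_lact mX) (is_linearZ (linner_linear mX _)) -xy.
Qed.

Lemma right_frame : exists n (x y : 'I_n -> X), \sum_i rinner (x i) (y i) = cone.
Proof.
have [n [z [s [Ss lt1]]]] := dense_span_near1 (rinner_full mX).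
have [c cb] := right_inverse_near1 lt1.
have [x /choice[y xy]] := choice Ss.
exists n, x, (fun i => ract (z i *: y i) c).
rewrite -cb cmul_suml; apply: eq_bigr => i _.
by rewrite (rinner_ract mX) (is_linearZ (rinner_linear mX _)) -xy.
Qed.

(** The reconstruction formula of a frame: <x,y> z = x <y,z>. *)
Lemma left_frame_expand (I : finType) (x y : I -> X) z :
  \sum_i linner (x i) (y i) = cone ->
  z = \sum_i ract (x i) (rinner (y i) z).
Proof.
move=> xy; rewrite -[z in LHS](lact1 mX) -xy lact_suml.
by apply: eq_bigr => i _; rewrite (linner_rinner mX).
Qed.

Lemma lact_inj a b : (forall x, lact a x = lact b x) -> a = b.
Proof.
move=> ab; have [n [x [y xy]]] := left_frame.
rewrite -[a]cmul1r -[b]cmul1r -xy !cmul_sumr.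
by apply: eq_bigr => i _; rewrite -!(linner_lact mX) ab.
Qed.

Lemma ract_inj a b : (forall x, ract x a = ract x b) -> a = b.
Proof.
move=> ab; have [n [x [y xy]]] := right_frame.
rewrite -[a]cmul1l -[b]cmul1l -xy !cmul_suml.
by apply: eq_bigr => i _; rewrite -!(rinner_ract mX) ab.
Qed.

Lemma rinner_inj x y : (forall z, rinner z x = rinner z y) -> x = y.
Proof.
move=> xy; have [n [u [v uv]]] := left_frame.
rewrite (left_frame_expand x uv) (left_frame_expand y uv).
by apply: eq_bigr => i _; rewrite xy.
Qed.

Lemma rinner_injl x y : (forall z, rinner x z = rinner y z) -> x = y.
Proof.
move=> xy; apply: rinner_inj => z.
by rewrite -(rinner_star mX) xy (rinner_star mX).
Qed.

(** The left inner product alone gives this bound: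
    |a x|^2 = |a <x,x> a^*|. *)
Lemma norm_lact a x : `|lact a x| <= `|a| * `|x|.
Proof.
rewrite -(ler_pXn2r (n := 2)) ?nnegrE ?mulr_ge0// -(linner_norm mX).
rewrite (linner_lact mX) linner_lactr exprMn -(linner_norm mX).
rewrite (le_trans (cnormM _ _))// expr2 -mulrA ler_wpM2l//.
by rewrite mulrC (le_trans (cnormM _ _))// cnormV.
Qed.

(** Riesz representation; with a frame z is sum_i y_i f(x_i)^*. *)
Lemma right_linear_functional (f : X -> B) :
  is_linear f -> (forall x b, f (ract x b) = f x ** b) ->
  exists z, forall x, f x = rinner z x.
Proof.
move=> fl fr; have [n [x [y xy]]] := left_frame.
exists (\sum_i ract (y i) (cstar (f (x i)))) => z.
rewrite -(rinner_star mX) rinner_sumr cstar_sum.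
rewrite [z in LHS](left_frame_expand z xy) (is_linear_sum fl).
apply: eq_bigr => i _.
by rewrite fr (rinner_ract mX) cstarM cstarK (rinner_star mX).
Qed.

(** Over a unital algebra every right-linear endomorphism of X is of the form
    sum_i |f(x_i)><y_i|, which the left action realises by an element of B. *)
Lemma right_linear_lact (f : X -> X) :
  is_linear f -> (forall x b, f (ract x b) = ract (f x) b) ->
  exists u, forall x, f x = lact u x.
Proof.
move=> fl fr; have [n [x [y xy]]] := left_frame.
exists (\sum_i linner (f (x i)) (y i)) => z.
rewrite [z in LHS](left_frame_expand z xy) (is_linear_sum fl) lact_suml.
by apply: eq_bigr => i _; rewrite fr (linner_rinner mX).
Qed.

(** The element u representing f is central because f is left linear, and
    unitary because f preserves the left inner product. *)
Lemma morita_auto_lact (f : X -> X) :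
  is_morita_iso f -> exists2 u, UZ B u & forall x, f x = lact u x.
Proof.
move=> fi.
have [u fu] := right_linear_lact (miso_linear fi) (miso_ract fi).
have uC a : u ** a = a ** u.
  by apply: lact_inj => x; rewrite !(lactM mX) -!fu (miso_lact fi).
have uu : u ** cstar u = cone.
  have [n [x [y xy]]] := left_frame.
  rewrite -[cstar u]cmul1l -xy cmul_suml cmul_sumr.
  apply: eq_bigr => i _.
  by rewrite -linner_lactr -(linner_lact mX) -!fu (miso_linner fi).
by exists u => //; split => //; rewrite -uC.
Qed.

Lemma lact_morita_iso u : UZ B u -> is_morita_iso (lact u : X -> X).
Proof.
move=> Uu; split.
- exists (lact (cstar u)) => x; rewrite -(lactM mX).
    by rewrite (UZ_mulVl Uu) (lact1 mX).
  by rewrite (UZ_mulVr Uu) (lact1 mX).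
- exact: lactr.
- by move=> a x; rewrite -!(lactM mX) (UZC _ Uu).
- by move=> x a; rewrite (lractA mX).
- move=> x y; rewrite (linner_lact mX) linner_lactr cmulA (UZC _ Uu) -cmulA.
  by rewrite (UZ_mulVr Uu) cmul1r.
- by move=> x y; rewrite (rinner_lact mX) -(lactM mX) (UZ_mulVl Uu) (lact1 mX).
Qed.

Lemma ract_morita_iso u : UZ B u -> is_morita_iso (fun x : X => ract x u).
Proof.
move=> Uu; split.
- exists (fun x => ract x (cstar u)) => x; rewrite -(ractM mX).
    by rewrite (UZ_mulVr Uu) (ract1 mX).
  by rewrite (UZ_mulVl Uu) (ract1 mX).
- exact: ractl.
- by move=> a x; rewrite (lractA mX).
- by move=> x a; rewrite -!(ractM mX) (UZC _ Uu).
- by move=> x y; rewrite (linner_ract mX) -(ractM mX) (UZ_mulVr Uu) (ract1 mX).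
- move=> x y; rewrite (rinner_ract mX) rinner_ractl -cmulA -(UZC _ Uu) cmulA.
  by rewrite (UZ_mulVl Uu) cmul1l.
Qed.

(** A crude bound from polarization, which [norm_rinner_lact] sharpens. *)
Lemma norm_rinner_crude x y : `|rinner x y| <= (`|x| + `|y|) ^+ 2 *+ 4.
Proof.
have sq (z : X) : `|rinner z z| = `|z| ^+ 2 := rinner_norm mX z.
have bound k : `|k| = 1 ->
    `|k *: rinner x y + Num.conj k *: rinner y x| <= (`|x| + `|y|) ^+ 2 *+ 2.
  move=> k1; have nk : `|k *: y| = `|y| by rewrite normrZ k1 mul1r.
  have -> : k *: rinner x y + Num.conj k *: rinner y x =
      rinner (x + k *: y) (x + k *: y) - rinner x x - rinner (k *: y) (k *: y).
    have cancel (p q r s : B) : p + q + (r + s) - p - s = q + r.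
      by apply/eqP; rewrite !subr_eq (addrC p) addrACA (addrC p s) addrA.
    rewrite rinnerDl !rinnerDr cancel rinnerZl.
    by rewrite (is_linearZ (rinner_linear mX _)).
  rewrite (le_trans (ler_normB _ _))// (le_trans (lerD (ler_normB _ _) (lexx _)))//.
  rewrite !sq nk -addrA mulr2n lerD//.
    by rewrite lerXn2r ?nnegrE ?addr_ge0// (le_trans (ler_normD _ _))// nk.
  by rewrite sqrrD -addrA lerD2l lerDr mulrn_wge0// mulr_ge0.
have b1 := bound 1 (normr1 _); have bi := bound 'i (normCi _).
have E : rinner x y *+ 2 = (1 *: rinner x y + Num.conj 1 *: rinner y x)
    - 'i *: ('i *: rinner x y + Num.conj 'i *: rinner y x).
  rewrite conjC1 !scale1r conjCi scalerDr !scalerA mulrN -expr2 sqrCi opprK.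
  by rewrite scale1r scaleN1r opprD opprK addrACA subrr addr0.
rewrite -(ler_pMn2r (n := 2))// -normrMn E (le_trans (ler_normB _ _))//.
rewrite normrZ normCi mul1r (le_trans (lerD b1 bi))// -mulrnDr -mulrnA.
by rewrite ler_wpMn2l ?exprn_ge0 ?addr_ge0.
Qed.

(** A case of the Cauchy-Schwarz inequality, obtained by the power trick. With
    d = <y,y> for the left inner product and F(c) = |<y, c y>|, the C*-identity
    gives F(c)^2 = F(c d c) for selfadjoint c. Iterating from a, the arguments c_k
    satisfy |c_k| |d| <= (|a| |d|)^(2^k), so that a bound F(c) <= K |c| |d|
    with any K yields F(a)^(2^k) <= K (|a| |d|)^(2^k). *)
Lemma norm_rinner_lact a y :
  cstar a = a -> `|rinner y (lact a y)| <= `|a| * `|y| ^+ 2.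
Proof.
pose d := linner y y; pose F c := `|rinner y (lact c y)|.
have dE : `|d| = `|y| ^+ 2 := linner_norm mX y.
have crude c : F c <= 16%:R * `|c| * `|d|.
  have [->|c0] := eqVneq c 0.
    rewrite /F (is_linear0 (lactl y)) (is_linear0 (rinner_linear mX y)).
    by rewrite !normr0 mulr0 mul0r.
  have nc : 0 < `|c| by rewrite normr_gt0.
  (* F is homogeneous, so c may be scaled to norm 1 before polarizing. *)
  have cE : c = `|c| *: (`|c|^-1 *: c) by rewrite scalerA divff ?gt_eqF// scale1r.
  rewrite /F {1}cE (is_linearZ (lactl y)) (is_linearZ (rinner_linear mX y)).
  rewrite normrZ normr_id mulrAC mulrC ler_pM2r//.
  apply: le_trans (norm_rinner_crude _ _) _.
  have n1 : `|lact (`|c|^-1 *: c) y| <= `|y|.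
    rewrite (le_trans (norm_lact _ _))// normrZ normfV normr_id.
    by rewrite mulVf ?gt_eqF// mul1r.
  rewrite mulr_natl dE.
  apply: le_trans (_ : (`|y| + `|y|) ^+ 2 *+ 4 <= _).
    by rewrite ler_wMn2r// lerXn2r ?nnegrE ?addr_ge0// lerD.
  by rewrite -mulr2n exprMn_n -mulrnA.
have square c : cstar c = c -> F c ^+ 2 = F (c ** d ** c).
  move=> cs; rewrite /F -cnorm_star (rinner_star mX) (rinner_lact mX) cs.
  rewrite -(rinner_ract mX) -(linner_rinner mX) (linner_lact mX) -(lactM mX).
  by [].
move=> sa.
have seq k : exists c, [/\ cstar c = c, F a ^+ (2 ^ k) = F c
    & `|c| * `|d| <= (`|a| * `|d|) ^+ (2 ^ k)].
  elim: k => [|k [c [cs Fc nc]]]; first by exists a; rewrite !expr1.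
  exists (c ** d ** c); split.
  - by rewrite !cstarM cs (linner_star mX) cmulA.
  - by rewrite expnS mulnC exprM Fc square.
  - rewrite expnS mulnC exprM.
    apply: le_trans (_ : (`|c| * `|d|) ^+ 2 <= _); last first.
      by rewrite lerXn2r ?nnegrE ?exprn_ge0 ?mulr_ge0.
    rewrite expr2 mulrA ler_wpM2r// (le_trans (cnormM _ _))//.
    by rewrite ler_wpM2r// cnormM.
rewrite -dE; apply: (@le_of_expr_le _ 16%:R) => [||k]; rewrite ?mulr_ge0//.
have [c [_ Fc nc]] := seq k.
by rewrite -/(F a) Fc (le_trans (crude c))// -mulrA ler_wpM2l.
Qed.

End Morita.

Section MoritaIso.
Context {R : realType} {B : cstarAlgType R}.
Implicit Types (X Y Z : bimod B) (p : bimod B -> Prop) (u v : B).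

Lemma morita_iso_id X : is_morita_iso (@id X).
Proof. by split => //; exists id. Qed.

Lemma morita_iso_comp X Y Z (g : Y -> Z) (f : X -> Y) :
  is_morita_iso g -> is_morita_iso f -> is_morita_iso (fun x => g (f x)).
Proof.
move=> gi fi; split.
- exact: (bij_comp (miso_bij gi) (miso_bij fi)).
- exact: is_linear_comp (miso_linear gi) (miso_linear fi).
- by move=> a x; rewrite (miso_lact fi) (miso_lact gi).
- by move=> x a; rewrite (miso_ract fi) (miso_ract gi).
- by move=> x y; rewrite (miso_linner gi) (miso_linner fi).
- by move=> x y; rewrite (miso_rinner gi) (miso_rinner fi).
Qed.

Lemma morita_iso_inv X Y (f : X -> Y) (g : Y -> X) :
  is_morita_iso f -> cancel f g -> cancel g f -> is_morita_iso g.
Proof.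
move=> fi fK gK; have fI := can_inj fK; split.
- by exists f.
- by move=> z x y; apply: fI; rewrite (miso_linear fi) !gK.
- by move=> a x; apply: fI; rewrite (miso_lact fi) !gK.
- by move=> x a; apply: fI; rewrite (miso_ract fi) !gK.
- by move=> x y; rewrite -(miso_linner fi) !gK.
- by move=> x y; rewrite -(miso_rinner fi) !gK.
Qed.

Lemma morita_iso_norm X Y (f : X -> Y) :
  is_morita X -> is_morita Y -> is_morita_iso f -> forall x, `|f x| = `|x|.
Proof.
move=> mX mY fi x; apply/eqP; rewrite -(@eqrXn2 _ 2)//; apply/eqP.
by rewrite -(rinner_norm mX) -(rinner_norm mY) (miso_rinner fi).
Qed.

Lemma pic_class_eq X Y : is_morita X -> is_morita Y ->
  (exists f : X -> Y, is_morita_iso f) -> pic_class X = pic_class Y.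
Proof.
move=> mX mY [f fi]; apply/funext => Z; apply/propext.
have [g fK gK] := miso_bij fi.
split=> -[mZ [h hi]]; split=> //.
- by exists (fun y => h (g y)); apply: morita_iso_comp (morita_iso_inv fi fK gK).
- by exists (fun x => h (f x)); apply: morita_iso_comp.
Qed.

(** Since classes are closed under isomorphism, any element of a class represents
    it. *)
Lemma Pic_eq_class p X : Pic B p -> p X -> is_morita X /\ p = pic_class X.
Proof.
move=> [Y [mY ->]] [mX YX]; split=> //.
exact: pic_class_eq.
Qed.

(** * The action of the Picard group on UZ(B) *)

Section PicardAction.
Variables (p : bimod B -> Prop) (X : bimod B).
Hypotheses (Pp : Pic B p) (pX : p X).

Let mX : is_morita X := (Pic_eq_class Pp pX).1.

(** Right multiplication by a central unitary is an automorphism of X, hence a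
    left multiplication by a central unitary; isomorphisms carry the latter to
    the other members of the class. *)
Let pic_act_spec u : UZ B u ->
  UZ B (pic_act p u) /\
  forall Y, p Y -> forall y : Y, lact (pic_act p u) y = ract y u.
Proof.
move=> Uu.
apply: (@xgetPex _ cone [set v | UZ B v /\ forall Y, p Y -> forall y : Y, _ = _]).
have [v Uv vX] := morita_auto_lact mX (ract_morita_iso mX Uu).
exists v; split=> // Y; rewrite (Pic_eq_class Pp pX).2 => -[mY [f fi]] y.
have [g fK gK] := miso_bij fi.
by rewrite -[y]gK -(miso_lact fi) -(miso_ract fi) vX.
Qed.

Lemma pic_act_UZ u : UZ B u -> UZ B (pic_act p u).
Proof. by move=> /pic_act_spec[]. Qed.

Lemma lact_pic_act u (x : X) : UZ B u -> lact (pic_act p u) x = ract x u.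
Proof. by move=> /pic_act_spec[_ /(_ X pX)]. Qed.

Lemma pic_actM u v : UZ B u -> UZ B v ->
  pic_act p (u ** v) = pic_act p u ** pic_act p v.
Proof.
move=> Uu Uv; apply: (lact_inj mX) => x.
rewrite (lactM mX) !lact_pic_act//; last exact: UZM.
by rewrite -(ractM mX) (UZC _ Uu).
Qed.

Lemma pic_act1 : pic_act p cone = cone.
Proof.
apply: (lact_inj mX) => x.
by rewrite lact_pic_act ?(lact1 mX) ?(ract1 mX)//; exact: UZ1.
Qed.

End PicardAction.

End MoritaIso.

(** * Internal tensor products *)

Section TensorProducts.
Context {R : realType} {B : cstarAlgType R} {X Y : bimod B}.
Hypotheses (mX : is_morita X) (mY : is_morita Y).
Variable T : tensorProduct X Y.

Let mT := tens_morita T.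

(** Contracting a frame of Y inside a frame of X leaves the frame of X, by the
    formula for the inner product of elementary tensors. *)
Lemma tens_frame : exists (I : finType) (x x' : I -> X) (y y' : I -> Y),
  \sum_i linner (tens T (x i) (y i)) (tens T (x' i) (y' i)) = cone.
Proof.
have [n [x [x' xx']]] := left_frame mX.
have [m [y [y' yy']]] := left_frame mY.
exists ('I_n * 'I_m)%type, (fun k => x k.1), (fun k => x' k.1),
  (fun k => y k.2), (fun k => y' k.2).
rewrite -xx' -(pair_bigA _ (fun i j =>
  linner (tens T (x i) (y j)) (tens T (x' i) (y' j)))) /=.
apply: eq_bigr => i _.
under eq_bigr => j _ do rewrite tens_linner.
by rewrite -(linner_suml mX) -(ract_sumr mX) yy' (ract1 mX).
Qed.

(** A frame of elementary tensors shows that the algebraic tensor product is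
    already complete. *)
Lemma tens_expand (t : T) : exists (I : finType) (x : I -> X) (y : I -> Y),
  t = \sum_i tens T (x i) (y i).
Proof.
have [I [x [x' [y [y' xy]]]]] := tens_frame.
exists I, x, (fun i => ract (y i) (rinner (tens T (x' i) (y' i)) t)).
rewrite [LHS](left_frame_expand mT t xy).
by apply: eq_bigr => i _; rewrite tens_ract.
Qed.

Lemma tens_ind (P : T -> Prop) :
  (forall s t, P s -> P t -> P (s + t)) -> (forall x y, P (tens T x y)) ->
  forall t, P t.
Proof.
move=> PD Pt t; have [I [x [y ->]]] := tens_expand t.
apply: (big_ind P) => //.
by rewrite -(is_linear0 ((tens_bilinear T).2 0)).
Qed.

(** |x (x) y|^2 = |<y, <x,x> y>|, and <x,x> is selfadjoint. *)
Lemma norm_tens x y : `|tens T x y| <= `|x| * `|y|.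
Proof.
rewrite -(@ler_pXn2r _ 2)// ?nnegrE ?mulr_ge0// -(rinner_norm mT) tens_rinner.
by rewrite exprMn -(rinner_norm mX) norm_rinner_lact// (rinner_star mX).
Qed.

(** A left-linear family beta with the inner products of elementary tensors
    extends to the tensor product, by transporting the frame expansion
    t = sum_i e_i <e'_i, t>. Its image is everything because beta carries the
    frame e, e' to a frame of Z. *)
Lemma tens_universal (Z : bimod B) (beta : X -> Y -> Z) :
  is_morita Z ->
  (forall a x y, lact a (beta x y) = beta (lact a x) y) ->
  (forall x y x' y', linner (beta x y) (beta x' y')
                     = linner (ract x (linner y y')) x') ->
  (forall x y x' y', rinner (beta x y) (beta x' y')
                     = rinner y (lact (rinner x x') y')) ->
  exists2 f : T -> Z, is_morita_iso f & forall x y, f (tens T x y) = beta x y.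
Proof.
move=> mZ betal betaL betaR.
have [I [x [x' [y [y' xy]]]]] := tens_frame.
have bxy : \sum_i linner (beta (x i) (y i)) (beta (x' i) (y' i)) = cone.
  by rewrite -xy; apply: eq_bigr => i _; rewrite betaL tens_linner.
pose f t := \sum_i ract (beta (x i) (y i)) (rinner (tens T (x' i) (y' i)) t).
pose g z := \sum_i ract (tens T (x i) (y i)) (rinner (beta (x' i) (y' i)) z).
have ftens u v : f (tens T u v) = beta u v.
  rewrite (left_frame_expand mZ (beta u v) bxy); apply: eq_bigr => i _.
  by rewrite betaR tens_rinner.
have fl : is_linear f.
  move=> k s t; rewrite scaler_sumr -big_split; apply: eq_bigr => i _.
  by rewrite (rinner_linear mT) ((ract_bilinear mZ).2 _).
have fR s t : rinner (f s) (f t) = rinner s t.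
  move: s; apply: tens_ind => [s s' sE s'E|u v].
    by rewrite (is_linearD fl) (rinnerDl mZ) (rinnerDl mT) sE s'E.
  move: t; apply: tens_ind => [t t' tE t'E|u' v'].
    by rewrite (is_linearD fl) (rinnerDr mZ) (rinnerDr mT) tE t'E.
  by rewrite !ftens betaR tens_rinner.
have fL s t : linner (f s) (f t) = linner s t.
  move: s; apply: tens_ind => [s s' sE s'E|u v].
    by rewrite (is_linearD fl) (linnerDl mZ) (linnerDl mT) sE s'E.
  move: t; apply: tens_ind => [t t' tE t'E|u' v'].
    by rewrite (is_linearD fl) (linnerDr mZ) (linnerDr mT) tE t'E.
  by rewrite !ftens betaL tens_linner.
have fract t b : f (ract t b) = ract (f t) b.
  rewrite (ract_suml mZ); apply: eq_bigr => i _.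
  by rewrite (rinner_ract mT) (ractM mZ).
exists f => //; split=> //.
- exists g => [t|z].
    rewrite [RHS](left_frame_expand mT t xy); apply: eq_bigr => i _.
    by rewrite -ftens fR.
  rewrite (is_linear_sum fl) [RHS](left_frame_expand mZ z bxy).
  apply: eq_bigr => i _.
  by rewrite fract ftens.
- move=> a; apply: tens_ind => [s t sE tE|u v].
    by rewrite (is_linearD ((lact_bilinear mT).2 _)) !(is_linearD fl)
      (is_linearD ((lact_bilinear mZ).2 _)) sE tE.
  by rewrite tens_lact !ftens betal.
Qed.

End TensorProducts.

(** * The total space of a bundle *)

Section TotalSpace.
Context {R : realType} {G : groupType} {B : cstarAlgType R} (E : fell G B).

Definition total_space := {g : G & fib E g}.

(** Fibres over equal group elements are different types. Comparing elements in
    the total space removes the transports from the axioms of a bundle, which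
    become those of a semigroup with involution. *)
Definition inT g (s : fib E g) : total_space := existT (fun g => fib E g : Type) g s.

Definition tmul (s t : total_space) : total_space := inT (fmul (tagged s) (tagged t)).

Definition tstar (s : total_space) : total_space := inT (fstar (tagged s)).

Definition tunit (a : B) : total_space := inT (funit E a).

Lemma inT_inj g : injective (@inT g).
Proof.
move=> s t st; apply/eqP.
by rewrite -(@eq_Tagged G (fun g => fib E g) (inT s)); apply/eqP.
Qed.

Lemma inT_fcast g h (e : g = h) (s : fib E g) : inT (fcast e s) = inT s.
Proof. by case: _ / e. Qed.

Lemma tmulE g h (s : fib E g) (t : fib E h) :
  tmul (inT s) (inT t) = inT (fmul s t).
Proof. by []. Qed.

Lemma tstarE g (s : fib E g) : tstar (inT s) = inT (fstar s).
Proof. by []. Qed.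

Hypothesis unit_bij : bijective (funit E).

Lemma funit_invK s : funit E (funit_inv s) = s.
Proof.
apply: (@xgetPex _ 0 [set b | funit E b = s]).
by have [f _ fK] := unit_bij; exists (f s).
Qed.

Lemma tunit_inj : injective tunit.
Proof. by move=> a b /inT_inj; apply: bij_inj. Qed.

Lemma funitK : cancel (funit E) (@funit_inv _ _ _ E).
Proof. by move=> b; apply: (bij_inj unit_bij); rewrite funit_invK. Qed.

Lemma total_lact g a (s : fell_bimod E g) :
  inT (lact a s) = tmul (tunit a) (inT s).
Proof. exact: inT_fcast. Qed.

Lemma total_ract g (s : fell_bimod E g) a :
  inT (ract s a) = tmul (inT s) (tunit a).
Proof. exact: inT_fcast. Qed.

Lemma total_linner g (s t : fell_bimod E g) :
  tunit (linner s t) = tmul (inT s) (tstar (inT t)).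
Proof. by rewrite /tunit funit_invK inT_fcast. Qed.

Lemma total_rinner g (s t : fell_bimod E g) :
  tunit (rinner s t) = tmul (tstar (inT s)) (inT t).
Proof. by rewrite /tunit funit_invK inT_fcast. Qed.

End TotalSpace.

Section FellTotal.
Context {R : realType} {G : groupType} {B : cstarAlgType R} (E : fell G B).
Hypothesis fE : is_fell E.
Implicit Types s t u : total_space E.

Lemma tmulA s t u : tmul s (tmul t u) = tmul (tmul s t) u.
Proof.
by rewrite /tmul /= -(fmulA fE) inT_fcast.
Qed.

Lemma tstarM s t : tstar (tmul s t) = tmul (tstar t) (tstar s).
Proof. by rewrite /tmul /tstar /= -(fstarM fE) inT_fcast. Qed.

Lemma tstarK s : tstar (tstar s) = s.
Proof.
case: s => g s; rewrite -/(inT s).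
by rewrite -[in RHS](fstarK fE s) inT_fcast.
Qed.

Lemma tunitM a b : tmul (tunit E a) (tunit E b) = tunit E (a ** b).
Proof. by rewrite /tunit -(funitM fE) inT_fcast. Qed.

Lemma tunit_star a : tstar (tunit E a) = tunit E (cstar a).
Proof. by rewrite /tunit -(funit_star fE) inT_fcast. Qed.

End FellTotal.

(** * From factor systems to bundles *)

Section Casts.
Context {R : realType} {G : groupType} {B : cstarAlgType R}.
Context {psi : G -> bimod B -> Prop} (M : representatives psi).
Variables (g h : G) (e : g = h).
Implicit Types s t : M g.

Lemma mcast_linear : is_linear (@mcast _ _ _ _ M g h e).
Proof. by case: _ / e. Qed.

Lemma mcast_lact a s : mcast e (lact a s) = lact a (mcast e s).
Proof. by case: _ / e. Qed.

Lemma mcast_ract a s : mcast e (ract s a) = ract (mcast e s) a.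
Proof. by case: _ / e. Qed.

Lemma mcast_linner s t : linner (mcast e s) (mcast e t) = linner s t.
Proof. by case: _ / e. Qed.

Lemma mcast_rinner s t : rinner (mcast e s) (mcast e t) = rinner s t.
Proof. by case: _ / e. Qed.

Lemma mcast_norm s : `|mcast e s| = `|s|.
Proof. by case: _ / e. Qed.

Lemma mcastKV (t : M h) : mcast e (mcast (esym e) t) = t.
Proof. by case: _ / e t. Qed.

Lemma mcast_rinnerV s (t : M h) :
  rinner (mcast e s) t = rinner s (mcast (esym e) t).
Proof. by rewrite -{1}[t]mcastKV mcast_rinner. Qed.

End Casts.

(** The last four fields of a bimodule are functions, so bimodules on the same
    carrier are equal as soon as their operations agree pointwise. *)
Lemma bimod_ext (R : realType) (B : cstarAlgType R) (X : bimod B) l r L R' :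
  (forall a x, l a x = lact a x) -> (forall x a, r x a = ract x a) ->
  (forall x y, L x y = linner x y) -> (forall x y, R' x y = rinner x y) ->
  @Bimod R B X l r L R' = X.
Proof.
case: X l r L R' => X l r L R' l' r' L' R'' /= lE rE LE RE.
have -> : l' = l by apply/funext => a; apply/funext => x.
have -> : r' = r by apply/funext => x; apply/funext => a.
have -> : L' = L by apply/funext => x; apply/funext => y.
by have -> : R'' = R' by apply/funext => x; apply/funext => y.
Qed.

Lemma dense_span_sums (R : realType) (V : completeNormedModType R[i]) (S : set V) :
  (forall x, exists (I : finType) (s : I -> V),
    (forall i, S (s i)) /\ x = \sum_i s i) ->
  dense (lin_span S).
Proof.
move=> Ssum O [x Ox] _; exists x; split=> //.
have [I [s [Ss ->]]] := Ssum x.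
exists #|I|, (fun=> 1), (fun i => s (enum_val i)); split=> //.
under [RHS]eq_bigr do rewrite scale1r.
rewrite (reindex (@enum_val I I))//=.
exact/onW_bij/enum_val_bij.
Qed.

Section FactorSystems.
Context {R : realType} {G : groupType} {B : cstarAlgType R}.
Context {psi : G -> bimod B -> Prop} (psiP : forall g, Pic B (psi g)).
Variable M : representatives psi.

Lemma repr_morita g : is_morita (M g).
Proof. exact: (Pic_eq_class (psiP g) (repr_psi M g)).1. Qed.

Lemma psi_class g : psi g = pic_class (M g).
Proof. exact: (Pic_eq_class (psiP g) (repr_psi M g)).2. Qed.

Let mM := repr_morita.
Let m1 := repr_one_iso M.

Lemma lact_repr_one a b : lact a (repr_one M b) = repr_one M (a ** b).
Proof. by rewrite -(miso_lact m1). Qed.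

Lemma ract_repr_one a b : ract (repr_one M a) b = repr_one M (a ** b).
Proof. by rewrite -(miso_ract m1). Qed.

Lemma rinner_repr_one a b : rinner (repr_one M a) (repr_one M b) = cstar a ** b.
Proof. by rewrite (miso_rinner m1). Qed.

Lemma linner_repr_one a b : linner (repr_one M a) (repr_one M b) = a ** cstar b.
Proof. by rewrite (miso_linner m1). Qed.

Lemma repr_one_surj (s : M 1%g) : exists b, s = repr_one M b.
Proof. by have [f _ fK] := miso_bij m1; exists (f s). Qed.

Lemma norm_repr_one b : `|repr_one M b| = `|b|.
Proof.
apply/eqP; rewrite -(@eqrXn2 _ 2)//; apply/eqP.
by rewrite -(rinner_norm (mM _)) rinner_repr_one cnorm_star.
Qed.

Variable Psi : factor_data M.
Arguments Psi : clear implicits.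
Hypothesis fsP : factor_system Psi.

Local Notation E := (fs_bundle Psi).
Local Notation "s ⊙ t" := (fs_mul Psi s t) (at level 40, left associativity).
Local Notation tot s := (@inT _ _ _ E _ s).
Local Notation "s ^**" := (@fstar _ _ _ E _ s) (at level 2).

Let iso g h := fs_iso fsP g h.

Lemma fs_mul_bilinear g h : is_bilinear (@fs_mul _ _ _ _ _ Psi g h).
Proof.
split=> x; apply: is_linear_comp (miso_linear (iso g h)) _.
- exact: (tens_bilinear _).1.
- exact: (tens_bilinear _).2.
Qed.

Lemma fs_mul_lact g h a (s : M g) (t : M h) : lact a s ⊙ t = lact a (s ⊙ t).
Proof. by rewrite /fs_mul -tens_lact (miso_lact (iso g h)). Qed.

Lemma fs_mul_ract g h a (s : M g) (t : M h) : s ⊙ ract t a = ract (s ⊙ t) a.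
Proof. by rewrite /fs_mul -tens_ract (miso_ract (iso g h)). Qed.

Lemma fs_mul_balanced g h a (s : M g) (t : M h) : ract s a ⊙ t = s ⊙ lact a t.
Proof. by rewrite /fs_mul tens_balanced. Qed.

Lemma fs_mul_linner g h (s s' : M g) (t t' : M h) :
  linner (s ⊙ t) (s' ⊙ t') = linner (ract s (linner t t')) s'.
Proof. by rewrite (miso_linner (iso g h)) tens_linner. Qed.

Lemma fs_mul_rinner g h (s s' : M g) (t t' : M h) :
  rinner (s ⊙ t) (s' ⊙ t') = rinner t (lact (rinner s s') t').
Proof. by rewrite (miso_rinner (iso g h)) tens_rinner. Qed.

Lemma fs_mul_norm g h (s : M g) (t : M h) : `|s ⊙ t| <= `|s| * `|t|.
Proof.
rewrite (morita_iso_norm (tens_morita _) (mM _) (iso g h)).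
exact: norm_tens.
Qed.

(** The products span the fibres without closure; this is both saturation and
    the tool for checking identities in a fibre on products. *)
Lemma fs_mul_expand g h (x : M (g * h)%g) :
  exists (I : finType) (s : I -> M g) (t : I -> M h), x = \sum_i s i ⊙ t i.
Proof.
have [f _ fK] := miso_bij (iso g h).
have [I [s [t fx]]] := tens_expand (mM g) (mM h) (f x).
exists I, s, t; rewrite -[x]fK fx.
exact: (is_linear_sum (miso_linear (iso g h))).
Qed.

Lemma fs_mul_rinner_inj g h k (e : (g * h)%g = k) (x y : M k) :
  (forall (s : M g) (t : M h),
    rinner x (mcast e (s ⊙ t)) = rinner y (mcast e (s ⊙ t))) -> x = y.
Proof.
move=> xy; apply: (rinner_injl (mM k)) => z; rewrite -[z](mcastKV e).
have [I [s [t ->]]] := fs_mul_expand (mcast (esym e) z).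
rewrite (is_linear_sum (mcast_linear e)) !(rinner_sumr (mM k)).
by apply: eq_bigr => i _; rewrite xy.
Qed.

Lemma inT_mcast g h (e : g = h) (s : M g) : tot (mcast e s) = tot s.
Proof. exact: (@inT_fcast _ _ _ E). Qed.

Lemma tmul_fs g h (s : M g) (t : M h) : tmul (tot s) (tot t) = tot (s ⊙ t).
Proof. by []. Qed.

Lemma fs_tmulA (s t u : total_space E) : tmul s (tmul t u) = tmul (tmul s t) u.
Proof.
case: s t u => [g s] [h t] [k u].
by rewrite /tmul /= -(fs_assoc fsP) inT_mcast.
Qed.

Lemma fs_tunitM a b : tmul (tunit E a) (tunit E b) = tunit E (a ** b).
Proof. by rewrite /tunit -[funit E (a ** b)](fs_one fsP) inT_mcast. Qed.

(** The map f is s |-> 1 s. It preserves inner products, so it is injective, and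
    it is idempotent by associativity; hence it is the identity. *)
Lemma fs_mul1l g a (s : M g) : tmul (tunit E a) (tot s) = tot (lact a s).
Proof.
pose f (s : M g) : M g := mcast (mul1g g) (repr_one M cone ⊙ s).
have fE s' : tmul (tunit E cone) (tot s') = tot (f s') by rewrite inT_mcast.
have fI : injective f.
  move=> x y xy; apply: (rinner_inj (mM g)) => z.
  have fR w : rinner (f z) (f w) = rinner z w.
    rewrite mcast_rinner fs_mul_rinner rinner_repr_one cstar1 cmul1l.
    by rewrite (lact1 (mM g)).
  by rewrite -!fR xy.
have f1 s' : f s' = s'.
  apply: fI; apply: (@inT_inj _ _ _ E).
  by rewrite -fE -fE fs_tmulA fs_tunitM cmul1l fE.
rewrite -[in RHS](f1 s) -mcast_lact inT_mcast -fs_mul_lact lact_repr_one.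
by rewrite cmul1r.
Qed.

(** As on the left, with the left inner product in place of the right one. *)
Lemma fs_mul1r g a (s : M g) : tmul (tot s) (tunit E a) = tot (ract s a).
Proof.
pose f (s : M g) : M g := mcast (mulg1 g) (s ⊙ repr_one M cone).
have fE s' : tmul (tot s') (tunit E cone) = tot (f s') by rewrite inT_mcast.
have fI : injective f.
  move=> x y xy; apply: (linner_inj (mM g)) => z.
  have fL w : linner (f w) (f z) = linner w z.
    rewrite mcast_linner fs_mul_linner linner_repr_one cstar1 cmul1l.
    by rewrite (ract1 (mM g)).
  by rewrite -!fL xy.
have f1 s' : f s' = s'.
  apply: fI; apply: (@inT_inj _ _ _ E).
  by rewrite -fE -fE -fs_tmulA fs_tunitM cmul1l fE.
rewrite -[in RHS](f1 s) -mcast_ract inT_mcast -fs_mul_ract ract_repr_one.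
by rewrite cmul1l.
Qed.

(** By right linearity, t |-> s t is the inner product with some z in the fibre
    over the inverse; taking adjoints shows that z is lambda_s^*(1). *)
Lemma fs_lambdaE g (s : M g) (x : M g^-1%g) :
  fs_lambda Psi s x = repr_one M (rinner (s^** : M g^-1%g) x).
Proof.
pose e : M 1%g := repr_one M cone.
have [z zP] : exists z : M g^-1%g,
    forall x, rinner e (fs_lambda Psi s x) = rinner z x.
  apply: (right_linear_functional (mM _)) => [|y b].
    apply: is_linear_comp (rinner_linear (mM _) e) _.
    exact: is_linear_comp (mcast_linear _) ((fs_mul_bilinear _ _).2 s).
  by rewrite /fs_lambda fs_mul_ract mcast_ract (rinner_ract (mM _)).
have -> : s^** = z.
  apply: xget_unique => [y|y yP].
    by rewrite -(rinner_star (mM _)) zP (rinner_star (mM _)).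
  by apply: (rinner_inj (mM _)) => w; rewrite -yP -(rinner_star (mM _)) zP
    (rinner_star (mM _)).
have [b bE] := repr_one_surj (fs_lambda Psi s x).
by rewrite -zP bE rinner_repr_one cstar1 cmul1l.
Qed.

Lemma fs_unitl g a (s : M g) :
  mcast (mul1g g) (repr_one M a ⊙ s) = lact a s.
Proof. by apply: (@inT_inj _ _ _ E); rewrite inT_mcast -fs_mul1l. Qed.

Lemma fs_unitr g a (s : M g) :
  mcast (mulg1 g) (s ⊙ repr_one M a) = ract s a.
Proof. by apply: (@inT_inj _ _ _ E); rewrite inT_mcast -fs_mul1r. Qed.

Lemma fs_starP g (s : M g) (x : M g^-1%g) :
  tmul (tot s) (tot x) = tunit E (rinner (s^** : M g^-1%g) x).
Proof. by rewrite /tunit -[funit E _]fs_lambdaE inT_mcast. Qed.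

Let unit_bij : bijective (funit E) := miso_bij m1.

(** Both sides are elements of B. They are compared by their inner products with
    y z, where <s t^*, y z> = <t^*, <s,y> z> = (t <s,y>) z = (<t,s> y) z. *)
Lemma fs_linner g (s t : M g) :
  tmul (tot s) (tstar (tot t)) = tunit E (linner s t).
Proof.
have [b bE] := repr_one_surj (mcast (mulgV g) (s ⊙ t^**)).
suff -> : linner s t = b.
  by rewrite /tunit -[funit E b]bE inT_mcast.
apply: (bij_inj unit_bij); rewrite -[funit E b]bE.
apply: (fs_mul_rinner_inj (e := mulgV g)) => y z.
rewrite mcast_rinner fs_mul_rinner.
apply: (tunit_inj unit_bij); rewrite -fs_starP -fs_mul1l fs_tmulA fs_mul1r.
rewrite -(linner_rinner (mM g)) -fs_mul1l -fs_tmulA tmul_fs.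
have [c cE] := repr_one_surj (mcast (mulgV g) (y ⊙ z)).
rewrite cE -[tot _](inT_mcast (mulgV g)) cE rinner_repr_one (linner_star (mM g)).
by rewrite -fs_tunitM.
Qed.

(** For all y one has y (s^* t) = (y s^* ) t = <y,s> t = y <s,t>, and B acts
    faithfully. *)
Lemma fs_rinner g (s t : M g) :
  tmul (tstar (tot s)) (tot t) = tunit E (rinner s t).
Proof.
have [b bE] := repr_one_surj (mcast (mulVg g) (s^** ⊙ t)).
have tE : tmul (tstar (tot s)) (tot t) = tunit E b.
  by rewrite /tunit -[funit E b]bE inT_mcast.
rewrite tE; congr tunit; apply: (ract_inj (mM g)) => y.
apply: (@inT_inj _ _ _ E); rewrite -fs_mul1r -tE fs_tmulA fs_linner fs_mul1l.
by rewrite (linner_rinner (mM g)).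
Qed.

(** The fibres of the bundle are the chosen representatives with their own
    bimodule structure, so the bundle has the prescribed Picard homomorphism. *)
Lemma fell_bimod_fs_iso g : is_morita_iso (id : fell_bimod E g -> M g).
Proof.
split=> // [|a s|s a|s t|s t]; first by exists id.
- by apply: (@inT_inj _ _ _ E); rewrite inT_fcast -fs_mul1l.
- by apply: (@inT_inj _ _ _ E); rewrite inT_fcast -fs_mul1r.
- apply: (tunit_inj unit_bij).
  by rewrite [in RHS]/tunit funit_invK// inT_fcast -[LHS]fs_linner.
- apply: (tunit_inj unit_bij).
  by rewrite [in RHS]/tunit funit_invK// inT_fcast -[LHS]fs_rinner.
Qed.

Lemma fell_bimod_fs g : fell_bimod E g = M g.
Proof.
have i := fell_bimod_fs_iso g.
apply: bimod_ext => [a s|s a|s t|s t].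
- exact: (miso_lact i).
- exact: (miso_ract i).
- exact/esym/(miso_linner i).
- exact/esym/(miso_rinner i).
Qed.

Lemma fs_is_fell : is_fell E.
Proof.
have inj := @inT_inj _ _ _ E.
split.
- exact: fs_mul_bilinear.
- by move=> g h k s t u; apply: inj; rewrite inT_fcast; apply: fs_tmulA
    (tot s) (tot t) (tot u).
- exact: fs_mul_norm.
- move=> g z s t; apply: (rinner_injl (mM _)) => x.
  rewrite (rinnerDl (mM _)) (rinnerZl (mM _)) conjCK.
  apply: (bij_inj (miso_bij m1)); rewrite (miso_linear m1) -!fs_lambdaE.
  by rewrite /fs_lambda ((fs_mul_bilinear _ _).1 x) (mcast_linear _).
- move=> g h s t; apply: (fs_mul_rinner_inj (e := erefl _)) => x y.
  rewrite [fcast _ _]/(mcast (invgM g h) (s ⊙ t)^** ) [mcast erefl _]/(x ⊙ y).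
  apply: (tunit_inj unit_bij); rewrite mcast_rinnerV -fs_starP inT_mcast.
  rewrite [fmul _ _]/(t^** ⊙ s^** ) fs_mul_rinner -fs_starP -fs_mul1l -fs_starP.
  by rewrite -!tmul_fs !fs_tmulA.
- move=> g s; apply: (rinner_injl (mM _)) => x.
  apply: (tunit_inj unit_bij).
  rewrite -[RHS]fs_rinner [fcast _ _]/(mcast (invgK g) s^** ^** ).
  by rewrite mcast_rinnerV -fs_starP inT_mcast.
- move=> g s; rewrite -(rinner_norm (mM _)) -norm_repr_one.
  rewrite -(mcast_norm (mulVg g)); congr (`| _ |).
  apply: inj; rewrite inT_mcast.
  exact: (fs_rinner s s).
- move=> g s.
  suff -> : funit_inv (fcast (mulVg g) (fmul (fstar s) s)) = rinner (s : M g) s.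
    exact: (rinner_pos (mM g)).
  apply: (tunit_inj unit_bij).
  by rewrite /tunit funit_invK// inT_fcast -[RHS]fs_rinner.
- exact: unit_bij.
- exact: miso_linear m1.
- exact: norm_repr_one.
- exact: (fs_one fsP).
- move=> a; apply: (rinner_injl (mM _)) => x; have [b ->] := repr_one_surj x.
  rewrite [fcast _ _]/(mcast (invg1 G) (repr_one M a)^** ).
  rewrite mcast_rinnerV rinner_repr_one cstarK.
  apply: (tunit_inj unit_bij); rewrite -fs_starP inT_mcast.
  exact: fs_tunitM.
Qed.

Lemma fs_fell_over : fell_over psi E.
Proof.
split.
- exact: fs_is_fell.
- move=> g h; apply: dense_span_sums => x.
  have [I [s [t xE]]] := fs_mul_expand x.
  by exists I, (fun i => s i ⊙ t i); split=> // i; exists (s i), (t i).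
- by move=> g; rewrite /picard fell_bimod_fs psi_class.
Qed.

End FactorSystems.

(** * From bundles to factor systems *)

Section BundleEquivalence.
Context {R : realType} {G : groupType} {B : cstarAlgType R}.
Implicit Types E F K : fell G B.

Lemma fell_equiv_refl E : fell_equiv E E.
Proof. by exists (fun g => id); split=> // g; split=> //; exists id. Qed.

Lemma fell_equiv_sym E F : fell_equiv E F -> fell_equiv F E.
Proof.
move=> [f [fb fu fm fs]].
have inv g : exists k : fib F g -> fib E g, cancel (f g) k /\ cancel k (f g).
  by have [[k fK kK] _ _] := fb g; exists k.
pose k g := projT1 (cid (inv g)).
have fK g : cancel (f g) (k g) := (projT2 (cid (inv g))).1.
have kK g : cancel (k g) (f g) := (projT2 (cid (inv g))).2.
exists k; split=> [g|b|g h s t|g s]; last 3 first.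
- by rewrite -fu fK.
- by apply: (can_inj (fK _)); rewrite -fm !kK.
- by apply: (can_inj (fK _)); rewrite -fs !kK.
have [_ fl fn] := fb g; split.
- by exists (f g).
- by move=> z s t; apply: (can_inj (fK g)); rewrite fl !kK.
- by move=> s; rewrite -fn kK.
Qed.

Lemma fell_equiv_trans E F K :
  fell_equiv E F -> fell_equiv F K -> fell_equiv E K.
Proof.
move=> [f [fb fu fm fs]] [k [kb ku km ks]].
exists (fun g s => k g (f g s)); split=> [g|b|g h s t|g s]; last 3 first.
- by rewrite fu ku.
- by rewrite km fm.
- by rewrite ks fs.
have [fbij fl fn] := fb g; have [kbij kl kn] := kb g; split.
- exact: (bij_comp kbij fbij).
- exact: is_linear_comp kl fl.
- by move=> s; rewrite kn fn.
Qed.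

Lemma fell_class_eq psi E F : fell_over psi E -> fell_over psi F ->
  fell_class psi E = fell_class psi F <-> fell_equiv E F.
Proof.
move=> oE oF; split=> [EF|EF].
  have : fell_class psi F F by split=> //; exact: fell_equiv_refl.
  by rewrite -EF => -[].
apply/funext => K; apply/propext; split=> -[oK eK]; split=> //.
  exact: fell_equiv_trans (fell_equiv_sym EF) eK.
exact: fell_equiv_trans EF eK.
Qed.

Lemma fcast_norm E g h (e : g = h) (s : fib E g) : `|fcast e s| = `|s|.
Proof. by case: _ / e. Qed.

Lemma fell_rinner_norm E g (s : fell_bimod E g) : is_fell E ->
  `|rinner s s| = `|s| ^+ 2.
Proof.
move=> fE; rewrite -(fnorm_star fE) -(funit_norm fE) funit_invK.
  exact: fcast_norm.
exact: funit_bij fE.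
Qed.

Section MapsOfBundles.
Variables (E F : fell G B) (f : forall g, fib E g -> fib F g).

Lemma fcast_map g h (e : g = h) s : f (fcast e s) = fcast e (f s).
Proof. by case: _ / e. Qed.

Definition tmap (s : total_space E) : total_space F := inT (f (tagged s)).

Hypotheses (fE : is_fell E) (fF : is_fell F).
Hypothesis f_unit : forall b, f (funit E b) = funit F b.
Hypothesis f_mul : forall g h (s : fib E g) (t : fib E h),
  fmul (f s) (f t) = f (fmul s t).

Lemma funit_inv_map s : funit_inv (f s) = funit_inv s.
Proof.
rewrite -[s in LHS](funit_invK (funit_bij fE)) f_unit.
exact: funitK (funit_bij fF) _.
Qed.

(** The bimodule structure of the fibres is written in terms of the
    multiplication and the involution of the bundle, so equivalences preserve
    it. *)
Lemma fell_equiv_morita_iso :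
  (forall g, bijective (@f g) /\ is_linear (@f g)) ->
  (forall g (s : fib E g), fstar (f s) = f (fstar s)) ->
  forall g, is_morita_iso (@f g : fell_bimod E g -> fell_bimod F g).
Proof.
move=> fbl fs g; have [fb fl] := fbl g; split=> // [a s|s a|s t|s t] /=.
- by rewrite fcast_map -f_mul f_unit.
- by rewrite fcast_map -f_mul f_unit.
- by rewrite fs f_mul -fcast_map funit_inv_map.
- by rewrite fs f_mul -fcast_map funit_inv_map.
Qed.

End MapsOfBundles.

End BundleEquivalence.

Section BundlesAndFactorSystems.
Context {R : realType} {G : groupType} {B : cstarAlgType R}.
Context {psi : G -> bimod B -> Prop} (psiP : forall g, Pic B (psi g)).
Variable M : representatives psi.
Implicit Types (E : fell G B) (Psi : factor_data M).

Let mM := repr_morita psiP M.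

(** Compatibility with the involution is automatic: s^* is determined by the
    products s x and the inner product. *)
Lemma fell_equiv_fs E Psi (f : forall g, fib E g -> M g) :
  is_fell E -> factor_system Psi ->
  (forall g, is_morita_iso (@f g : fell_bimod E g -> M g)) ->
  (forall b, f _ (funit E b) = repr_one M b) ->
  (forall g h (s : fib E g) (t : fib E h),
    fs_mul Psi (f _ s) (f _ t) = f _ (fmul s t)) ->
  fell_equiv E (fs_bundle Psi).
Proof.
move=> fE fP fi f_unit f_mul; have fF := fs_is_fell psiP fP.
exists f; split=> // [g|g s].
  split; [exact: miso_bij (fi g)|exact: (miso_linear (fi g))|move=> s].
  apply/eqP; rewrite -(@eqrXn2 _ 2)//; apply/eqP.
  by rewrite -(rinner_norm (mM g)) (miso_rinner (fi g)) fell_rinner_norm.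
apply: (rinner_injl (mM _)) => x.
have [k fK kK] := miso_bij (fi g^-1%g).
rewrite -[x]kK (miso_rinner (fi _)).
apply: (tunit_inj (funit_bij fF)); rewrite -(fs_starP psiP fP).
set b := rinner _ (k x).
have -> : tunit (fs_bundle Psi) b = tmap (F := fs_bundle Psi) f (tunit E b).
  by rewrite /tmap /tunit /= f_unit.
rewrite (total_rinner (funit_bij fE)) -tstarE (tstarK fE) /tmap /=.
by rewrite -f_mul.
Qed.

(** Over the unit the isomorphism cannot be arbitrary: it has to match the two
    identifications of the unit fibre with B. *)
Lemma fell_over_morita_iso E : fell_over psi E ->
  exists f : forall g, fib E g -> M g,
    (forall g, is_morita_iso (@f g : fell_bimod E g -> M g)) /\
    forall b, f _ (funit E b) = repr_one M b.
Proof.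
move=> [fE _ picE].
have fex g : exists f : fib E g -> M g,
    is_morita_iso (f : fell_bimod E g -> M g) /\
    forall (e : 1%g = g) b, f (fcast e (funit E b)) = mcast e (repr_one M b).
  have [g1|/eqP g1] := pselect (1%g = g); last first.
    have := repr_psi M g; rewrite -picE => -[_ [f fi]].
    by exists f; split=> // e; case/eqP: g1.
  case: _ / g1.
  have ub := funit_bij fE.
  exists (fun s => repr_one M (funit_inv s)); split; last first.
    by move=> e b; rewrite (eq_axiomK e) /= funitK.
  have [k kK fK] := ub.
  have uE : is_morita_iso (funit E : regular B -> fell_bimod E 1%g).
    split.
    - exact: ub.
    - exact: funit_linear fE.
    - move=> a b; apply: inT_inj; rewrite total_lact.
      exact/esym/(tunitM fE).
    - move=> a b; apply: inT_inj; rewrite total_ract.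
      exact/esym/(tunitM fE).
    - move=> a b; apply: (tunit_inj ub); rewrite total_linner//.
      by rewrite -/(tunit E a) -/(tunit E b) (tunit_star fE) (tunitM fE).
    - move=> a b; apply: (tunit_inj ub); rewrite total_rinner//.
      by rewrite -/(tunit E a) -/(tunit E b) (tunit_star fE) (tunitM fE).
  apply: morita_iso_comp (repr_one_iso M) _.
  exact: morita_iso_inv uE (funitK ub) (funit_invK ub).
pose f g := projT1 (cid (fex g)).
exists f; split=> [g|b]; first exact: (projT2 (cid (fex g))).1.
exact: (projT2 (cid (fex 1%g))).2 erefl b.
Qed.

(** The multiplication of E is transported to the representatives along the
    isomorphisms f; its inner products
    (s t)^* (s' t') = t^* (s^* s') t' and (s t) (s' t')^* = s (t t'^* ) s'^*
    are those of elementary tensors, so it factors through an isomorphism on the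
    tensor product. *)
Lemma factor_system_of_fell E : fell_over psi E ->
  exists2 Psi : factor_data M, factor_system Psi & fell_equiv E (fs_bundle Psi).
Proof.
move=> oE; have [fE _ _] := oE; have ub := funit_bij fE.
have [f [fi f_unit]] := fell_over_morita_iso oE.
have inv g : exists k : M g -> fib E g, cancel (f g) k /\ cancel k (f g).
  by have [k fK kK] := miso_bij (fi g); exists k.
pose k g := projT1 (cid (inv g)).
have fK g : cancel (f g) (k g) := (projT2 (cid (inv g))).1.
have kK g : cancel (k g) (f g) := (projT2 (cid (inv g))).2.
have ki g : is_morita_iso (k g : M g -> fell_bimod E g).
  exact: morita_iso_inv (fi g) (fK g) (kK g).
pose beta g h (s : M g) (t : M h) : M (g * h)%g := f _ (fmul (k _ s) (k _ t)).
have PsiP g h : exists2 F : repr_tens M g h -> M (g * h)%g,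
    is_morita_iso F & forall s t, F (tens (repr_tens M g h) s t) = beta g h s t.
  apply: (@tens_universal _ _ _ _ (mM g) (mM h) _ _ (beta g h) (mM _)).
  - move=> a s t; rewrite /beta -(miso_lact (fi _)); congr f; apply: inT_inj.
    by rewrite (miso_lact (ki g)) total_lact -!tmulE total_lact (tmulA fE).
  - move=> s t s' t'; rewrite (miso_linner (fi _)) -(miso_linner (ki g)).
    apply: (tunit_inj ub).
    rewrite (miso_ract (ki g)) -(miso_linner (ki h)) !total_linner//.
    rewrite total_ract total_linner// -!tmulE (tstarM fE).
    by rewrite !(tmulA fE).
  - move=> s t s' t'; rewrite (miso_rinner (fi _)) -(miso_rinner (ki h)).
    apply: (tunit_inj ub).
    rewrite (miso_lact (ki h)) -(miso_rinner (ki g)) !total_rinner//.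
    rewrite total_lact total_rinner// -!tmulE (tstarM fE).
    by rewrite !(tmulA fE).
pose Psi : factor_data M := fun g h => projT1 (cid2 (PsiP g h)).
have PsiE g h s t : fs_mul Psi s t = beta g h s t.
  rewrite /fs_mul /Psi; case: (cid2 _) => F /= _; exact.
have fsP : factor_system Psi.
  split.
  - by move=> g h; rewrite /Psi; case: (cid2 _).
  - move=> a b; rewrite PsiE /beta -!f_unit !fK.
    rewrite -[mcast _ _]/(fcast (E := fs_bundle Psi) (mulg1 1%g) _).
    by rewrite -fcast_map (funitM fE).
  - move=> g h l s t u; rewrite !PsiE /beta !fK.
    rewrite -[mcast _ _]/(fcast (E := fs_bundle Psi) (mulgA g h l) _).
    by rewrite -fcast_map (fmulA fE).
exists Psi => //; apply: (fell_equiv_fs fE fsP fi f_unit) => g h s t.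
by rewrite PsiE /beta !fK.
Qed.

Lemma ExtP e : Ext psi e <->
  exists Psi : factor_data M,
    factor_system Psi /\ e = fell_class psi (fs_bundle Psi).
Proof.
split=> [[E [oE ->]]|[Psi [fP ->]]]; last first.
  by exists (fs_bundle Psi); split=> //; exact: fs_fell_over.
have [Psi fP EP] := factor_system_of_fell oE.
exists Psi; split=> //; apply/fell_class_eq => //.
exact: fs_fell_over.
Qed.

End BundlesAndFactorSystems.

(** * Cocycles and coboundaries *)

Section Cohomology.
Context {R : realType} {G : groupType} {B : cstarAlgType R}.
Context {psi : G -> bimod B -> Prop} (psiP : forall g, Pic B (psi g)).
Implicit Types (w v b : G -> G -> B) (eta : G -> B).

Lemma cmulACA (x y z t : B) : UZ B y ->
  (x ** y) ** (z ** t) = (x ** z) ** (y ** t).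
Proof. by move=> Uy; rewrite -!cmulA (cmulA y) (UZC _ Uy) -cmulA. Qed.

Lemma UZ_quotientE (a c e x y : B) : UZ B a -> UZ B c -> UZ B e ->
  a ** cstar c ** e ** x = y <-> x ** e ** a = c ** y.
Proof.
move=> Ua Uc Ue.
have -> : a ** cstar c ** e ** x = cstar c ** (x ** e ** a).
  by rewrite (UZC _ Ua) -!cmulA (UZC _ Ua) (UZC x Ue) -cmulA.
split=> [<-|->]; first by rewrite cmulA (UZ_mulVr Uc) cmul1l.
by rewrite cmulA (UZ_mulVl Uc) cmul1l.
Qed.

Variable X : G -> bimod B.
Hypothesis psiX : forall g, psi g (X g).

Let actU g x (Ux : UZ B x) := pic_act_UZ (psiP g) (psiX g) Ux.
Let actM g x y (Ux : UZ B x) (Uy : UZ B y) := pic_actM (psiP g) (psiX g) Ux Uy.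
Let act1 g := pic_act1 (psiP g) (psiX g).

Lemma C1_one : C1 (fun _ : G => cone : B).
Proof. by split=> // g; exact: UZ1. Qed.

Lemma C1_mul eta eta' : C1 eta -> C1 eta' -> C1 (fun g => eta g ** eta' g).
Proof.
by move=> [U e] [U' e']; split=> [g|]; [exact: UZM|rewrite e e' cmul1l].
Qed.

Lemma C1_star eta : C1 eta -> C1 (fun g => cstar (eta g)).
Proof. by move=> [U e]; split=> [g|]; [exact: UZ_star|rewrite e cstar1]. Qed.

Lemma d1_UZ eta g h : C1 eta -> UZ B (d1 psi eta g h).
Proof.
move=> [U _]; rewrite /d1; apply: UZM (U g); apply: UZM (UZ_star (U _)).
exact: (actU g (U h)).
Qed.

Lemma d1_one : d1 psi (fun=> cone) = fun _ _ => cone.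
Proof.
by apply/funext => g; apply/funext => h; rewrite /d1 act1 cstar1 !cmul1l.
Qed.

Lemma d1_mul eta eta' : C1 eta -> C1 eta' ->
  d1 psi (fun g => eta g ** eta' g) = coch_mul (d1 psi eta) (d1 psi eta').
Proof.
move=> [U _] [U' _]; apply/funext => g; apply/funext => h.
rewrite /d1 /coch_mul actM// cstarM -(UZC _ (UZ_star (U _))).
rewrite [X in X ** _]cmulACA; last exact: (actU g (U' h)).
by rewrite cmulACA//; apply: UZM (UZ_star (U' _)); exact: (actU g (U' h)).
Qed.

Lemma B2_one : B2 psi (fun _ _ => cone).
Proof. by exists (fun=> cone); [exact: C1_one|exact: d1_one]. Qed.

Lemma B2_mul b b' : B2 psi b -> B2 psi b' -> B2 psi (coch_mul b b').
Proof.
move=> [eta C <-] [eta' C' <-]; exists (fun g => eta g ** eta' g).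
  exact: C1_mul.
exact: d1_mul.
Qed.

Lemma B2_UZ b g h : B2 psi b -> UZ B (b g h).
Proof. by move=> [eta C <-]; exact: d1_UZ. Qed.

Lemma B2_inv b : B2 psi b ->
  exists2 b', B2 psi b' & coch_mul b' b = fun _ _ => cone.
Proof.
move=> [eta C <-]; exists (d1 psi (fun g => cstar (eta g))).
  by exists (fun g => cstar (eta g)) => //; exact: C1_star.
rewrite -d1_mul//; last exact: C1_star.
rewrite -[RHS]d1_one; congr d1; apply/funext => g.
by have [U _] := C; rewrite (UZ_mulVl (U g)).
Qed.

Lemma coch_mulA w v b : coch_mul w (coch_mul v b) = coch_mul (coch_mul w v) b.
Proof. by apply/funext => g; apply/funext => h; exact: cmulA. Qed.

Lemma coch_mul1 w : coch_mul (fun _ _ => cone) w = w.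
Proof. by apply/funext => g; apply/funext => h; exact: cmul1l. Qed.

Lemma coch_mulC w v : (forall g h, UZ B (w g h)) -> coch_mul w v = coch_mul v w.
Proof. by move=> U; apply/funext => g; apply/funext => h; exact: UZC. Qed.

Lemma H2_class_self w : H2_class psi w w.
Proof. by exists (fun _ _ => cone); [exact: B2_one|exact: coch_mul1]. Qed.

Lemma H2_class_eq w v : H2_class psi w v -> H2_class psi v = H2_class psi w.
Proof.
move=> [b Bb <-]; apply/seteqP; split=> _ [c Bc <-].
  by exists (coch_mul c b); [exact: B2_mul|rewrite coch_mulA].
have [b' Bb' b'b] := B2_inv Bb.
exists (coch_mul c b'); first exact: B2_mul.
by rewrite -coch_mulA [X in coch_mul c X]coch_mulA b'b coch_mul1.
Qed.

Lemma Z2_UZ w g h : Z2 psi w -> UZ B (w g h).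
Proof. by move=> [[]]. Qed.

Lemma Z2_one : Z2 psi (fun _ _ => cone).
Proof.
split; first by split=> // g h; exact: UZ1.
by move=> g h k; rewrite act1.
Qed.

Lemma Z2_mul w v : Z2 psi w -> Z2 psi v -> Z2 psi (coch_mul w v).
Proof.
move=> [[Uw w1 w2] wZ] [[Uv v1 v2] vZ]; rewrite /coch_mul; split.
  split=> [g h|h|g]; first exact: UZM.
    by rewrite w1 v1 cmul1l.
  by rewrite w2 v2 cmul1l.
move=> g h k; rewrite actM// cmulACA; last exact: actU.
by rewrite wZ vZ cmulACA.
Qed.

Lemma H2_mul_class w v : Z2 psi w -> Z2 psi v ->
  H2_mul (H2_class psi w) (H2_class psi v) = H2_class psi (coch_mul w v).
Proof.
move=> Zw Zv; apply/seteqP; split=> x.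
  move=> [_ [b Bb <-] [_ [c Bc <-] <-]].
  exists (coch_mul b c); first exact: B2_mul.
  apply/funext => g; apply/funext => h.
  by rewrite /coch_mul cmulACA//; exact: B2_UZ Bc.
move=> [b Bb <-]; exists (coch_mul b w); first by exists b.
by exists v; [exact: H2_class_self|rewrite coch_mulA].
Qed.

End Cohomology.

(** * Twisting factor systems by cocycles *)

Section Twists.
Context {R : realType} {G : groupType} {B : cstarAlgType R}.
Context {psi : G -> bimod B -> Prop} (psiP : forall g, Pic B (psi g)).
Variable M : representatives psi.
Implicit Types (w v : G -> G -> B) (Psi : factor_data M).

Let mM := repr_morita psiP M.
Let psiM := repr_psi M.

Lemma fs_mul_twist w Psi g h (s : M g) (t : M h) :
  fs_mul (twist w Psi) s t = lact (w g h) (fs_mul Psi s t).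
Proof. by []. Qed.

Lemma factor_data_ext Psi Psi' :
  (forall g h t, Psi g h t = Psi' g h t) -> Psi = Psi'.
Proof.
move=> E; apply: functional_extensionality_dep => g.
by apply: functional_extensionality_dep => h; apply/funext.
Qed.

Lemma twist_mul w v Psi : twist (coch_mul w v) Psi = twist w (twist v Psi).
Proof.
apply: factor_data_ext => g h t.
exact: lactM (mM _) _ _ _.
Qed.

Lemma twist_one Psi : twist (fun _ _ => cone) Psi = Psi.
Proof.
apply: factor_data_ext => g h t.
exact: lact1 (mM _) _.
Qed.

(** A central unitary moves across M g by the action of psi g; this is the term
    by which the cocycle identity is twisted. *)
Lemma fs_mul_lactr Psi u g h (s : M g) (t : M h) : factor_system Psi -> UZ B u ->
  fs_mul Psi s (lact u t) = lact (pic_act (psi g) u) (fs_mul Psi s t).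
Proof.
move=> fP Uu; rewrite -(fs_mul_lact fP) -fs_mul_balanced.
by rewrite (lact_pic_act (psiP g) (psiM g)).
Qed.

Section TwistedTripleProducts.
Variables (w : G -> G -> B) (Psi : factor_data M).
Hypotheses (Uw : forall g h, UZ B (w g h)) (fP : factor_system Psi).
Variables (g h k : G) (s : M g) (t : M h) (u : M k).

Lemma twist_mulr :
  fs_mul (twist w Psi) s (fs_mul (twist w Psi) t u) =
  lact (pic_act (psi g) (w h k) ** w g (h * k)%g) (fs_mul Psi s (fs_mul Psi t u)).
Proof.
rewrite !fs_mul_twist fs_mul_lactr// -(lactM (mM _)).
by rewrite (UZC _ (Uw _ _)).
Qed.

Lemma twist_mull :
  fs_mul (twist w Psi) (fs_mul (twist w Psi) s t) u =
  lact (w (g * h)%g k ** w g h) (fs_mul Psi (fs_mul Psi s t) u).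
Proof. by rewrite !fs_mul_twist (fs_mul_lact fP) -(lactM (mM _)). Qed.

End TwistedTripleProducts.

Lemma twist_factor_system w Psi :
  Z2 psi w -> factor_system Psi -> factor_system (twist w Psi).
Proof.
move=> [[Uw w1 w2] wZ] fP; split.
- move=> g h; exact: morita_iso_comp (lact_morita_iso (mM _) (Uw _ _)) (fs_iso fP g h).
- by move=> a b; rewrite fs_mul_twist w1 (lact1 (mM _)) (fs_one fP).
- by move=> g h k s t u; rewrite twist_mulr// twist_mull// mcast_lact
    (fs_assoc fP) wZ.
Qed.

(** B acts faithfully on each fibre, and triple products span it. *)
Lemma fs_triple_lact_inj Psi g h k a b : factor_system Psi ->
  (forall (s : M g) (t : M h) (u : M k),
    lact a (fs_mul Psi (fs_mul Psi s t) u)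
    = lact b (fs_mul Psi (fs_mul Psi s t) u)) -> a = b.
Proof.
move=> fP ab; apply: (lact_inj (mM (g * h * k)%g)) => x.
have [I [y [u ->]]] := fs_mul_expand psiP fP x.
rewrite !(lact_sumr (mM _)); apply: eq_bigr => i _.
have [J [s [t ->]]] := fs_mul_expand psiP fP (y i).
rewrite (is_linear_sum ((fs_mul_bilinear fP _ _).1 _)) !(lact_sumr (mM _)).
by apply: eq_bigr => j _.
Qed.

(** Normalization of w comes from the fact that both factor systems restrict to
    the module actions of the unit fibre, and the cocycle identity from comparing
    the two associativity laws on triple products. *)
Lemma factor_systems_twist Psi Psi' : factor_system Psi -> factor_system Psi' ->
  exists2 w, Z2 psi w & Psi' = twist w Psi.
Proof.
move=> fP fP'.
have wex g h : exists u, UZ B u /\ forall t, Psi' g h t = lact u (Psi g h t).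
  have [f fK kK] := miso_bij (fs_iso fP g h).
  have fi := morita_iso_inv (fs_iso fP g h) fK kK.
  have [u Uu uE] := morita_auto_lact (mM _) (morita_iso_comp (fs_iso fP' g h) fi).
  by exists u; split=> // t; rewrite -uE fK.
pose w g h := projT1 (cid (wex g h)).
have Uw g h : UZ B (w g h) := (projT2 (cid (wex g h))).1.
have wE : Psi' = twist w Psi.
  apply: factor_data_ext => g h t.
  exact: (projT2 (cid (wex g h))).2.
exists w => //; rewrite wE in fP'; split; first split=> // [h|g].
- apply: (lact_inj (mM h)) => x; rewrite (lact1 (mM h)) -[RHS](lact1 (mM h)).
  rewrite -[RHS](fs_unitl psiP fP') fs_mul_twist mcast_lact.
  by rewrite (fs_unitl psiP fP) (lact1 (mM h)).
- apply: (lact_inj (mM g)) => x; rewrite (lact1 (mM g)) -[RHS](ract1 (mM g)).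
  rewrite -[RHS](fs_unitr psiP fP') fs_mul_twist mcast_lact.
  by rewrite (fs_unitr psiP fP) (ract1 (mM g)).
- move=> g h k; apply: (fs_triple_lact_inj (g := g) (h := h) (k := k) fP) => s t u.
  by rewrite -(twist_mull w fP) -(fs_assoc fP') twist_mulr// mcast_lact
    (fs_assoc fP).
Qed.

(** For f_g = left multiplication by eta(g), multiplicativity from the twist by w
    to the twist by v is the identity [key] compared with
    eta(gh) w(g,h) s t, that is w = d1 eta v. *)
Lemma fell_equiv_twist w v Psi : Z2 psi w -> Z2 psi v -> factor_system Psi ->
  fell_equiv (fs_bundle (twist w Psi)) (fs_bundle (twist v Psi)) <->
  H2_class psi v w.
Proof.
move=> Zw Zv fP.
have fw := twist_factor_system Zw fP; have fv := twist_factor_system Zv fP.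
have Fw := fs_is_fell psiP fw; have Fv := fs_is_fell psiP fv.
have key eta g h (s : M g) (t : M h) : (forall g, UZ B (eta g)) ->
    fs_mul (twist v Psi) (lact (eta g) s) (lact (eta h) t) =
    lact (v g h ** eta g ** pic_act (psi g) (eta h)) (fs_mul Psi s t).
  move=> Ue; rewrite fs_mul_twist (fs_mul_lact fP) fs_mul_lactr//.
  by rewrite -!(lactM (mM _)).
split=> [[f [fb fu fm fs]]|[_ [eta [Ue e1] <-] wE]].
  have fi g : exists u, UZ B u /\ forall s : M g, f g s = lact u s.
    have i : is_morita_iso (f g : M g -> M g).
      have fbl g' : bijective (f g') /\ is_linear (f g') by have [] := fb g'.
      have := fell_equiv_morita_iso Fw Fv fu fm fbl fs g.
      have [k kK fK] := miso_bij (fell_bimod_fs_iso psiP fw g).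
      move=> /(morita_iso_comp (fell_bimod_fs_iso psiP fv g)) i.
      apply: morita_iso_comp i _.
      exact: (morita_iso_inv (fell_bimod_fs_iso psiP fw g)).
    by have [u Uu uE] := morita_auto_lact (mM g) i; exists u.
  pose eta g := projT1 (cid (fi g)).
  have Ue g : UZ B (eta g) := (projT2 (cid (fi g))).1.
  have fE g s : f g s = lact (eta g) s := (projT2 (cid (fi g))).2 s.
  have e1 : eta 1%g = cone.
    have := fu cone; rewrite [funit _ _]/(repr_one M cone) fE lact_repr_one.
    by move/(bij_inj (miso_bij (repr_one_iso M))); rewrite !cmul1r.
  exists (d1 psi eta); first by exists eta.
  apply/funext => g; apply/funext => h; rewrite /coch_mul /d1.
  apply/UZ_quotientE => //; first exact: (pic_act_UZ (psiP g) (psiM g)).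
  apply: (lact_inj (mM (g * h)%g)) => x.
  have [I [s [t ->]]] := fs_mul_expand psiP fP x.
  rewrite !(lact_sumr (mM _)); apply: eq_bigr => i _.
  rewrite -key// -!fE (lactM (mM _)) -fE; exact: fm.
apply: (@fell_equiv_fs _ _ _ _ psiP _ (fs_bundle (twist w Psi)) _
  (fun g (s : M g) => lact (eta g) s : M g)) => // [g|b|g h s t].
- exact: morita_iso_comp (lact_morita_iso (mM g) (Ue g))
    (fell_bimod_fs_iso psiP fw g).
- by rewrite e1 (lact1 (mM _)).
- rewrite key// [fmul _ _]/(lact (w g h) (fs_mul Psi s t)) -(lactM (mM _)).
  congr lact; apply/UZ_quotientE => //.
    exact: (pic_act_UZ (psiP g) (psiM g)).
  by rewrite -wE.
Qed.

(** All pairs of a cocycle in x and a factor system of class e are admitted, so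
    that the action does not depend on choices by construction; that it yields a
    single class is [ext_act_class]. *)
Definition ext_act (x : set (G -> G -> B)) (e : fell G B -> Prop) :
    fell G B -> Prop :=
  fun F => exists w Psi, [/\ x w, Z2 psi w, factor_system Psi,
    e = fell_class psi (fs_bundle Psi) &
    fell_class psi (fs_bundle (twist w Psi)) F].

(** Another factor system of the same class is the twist by a coboundary v, so
    the pair (b w, Psi') leads to the twist of Psi by b v w. *)
Lemma ext_act_class w Psi : Z2 psi w -> factor_system Psi ->
  ext_act (H2_class psi w) (fell_class psi (fs_bundle Psi))
  = fell_class psi (fs_bundle (twist w Psi)).
Proof.
move=> Zw fP; have tover v (Zv : Z2 psi v) :=
  fs_fell_over psiP (twist_factor_system Zv fP).
apply/funext => F; apply/propext; split=> [|FP]; last first.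
  by exists w, Psi; split=> //; exact: (H2_class_self psiP psiM w).
move=> [w' [Psi' [[b Bb <-] Zw' fP' PP' FP]]].
have [v Zv vE] := factor_systems_twist fP fP'.
have Bv : B2 psi v.
  have : fell_equiv (fs_bundle (twist v Psi)) (fs_bundle (twist (fun _ _ => cone) Psi)).
    rewrite twist_one -vE; apply/(fell_class_eq (psi := psi)); last exact: esym.
    - exact: fs_fell_over.
    - exact: fs_fell_over.
  move=> /(fell_equiv_twist Zv (Z2_one psiP psiM) fP)[c Bc <-].
  by rewrite (coch_mulC _ (fun g h => B2_UZ psiP psiM g h Bc)) coch_mul1.
have Zbwv := Z2_mul psiP psiM Zw' Zv.
rewrite (_ : fell_class _ _ = 
    fell_class psi (fs_bundle (twist (coch_mul (coch_mul b w) v) Psi))).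
  by rewrite twist_mul -vE.
apply/fell_class_eq; [exact: tover|exact: tover|].
apply/(fell_equiv_twist Zw Zbwv fP).
rewrite (H2_class_eq psiP psiM (w := w)); first exact: (H2_class_self psiP psiM w).
exists (coch_mul b v); first exact: (B2_mul psiP psiM Bb Bv).
by rewrite -!coch_mulA (coch_mulC _ (fun g h => Z2_UZ g h Zv)).
Qed.

End Twists.

Theorem corollary4p5 (R : realType) (G : groupType) (B : cstarAlgType R)
    (psi : G -> bimod B -> Prop) (psi_hom : is_picard_hom psi)
    (Ext_nonempty : exists e, Ext psi e) (M : representatives psi) :
  exists act : set (G -> G -> B) -> (fell G B -> Prop) -> (fell G B -> Prop),
    [/\ forall x e, H2 psi x -> Ext psi e -> Ext psi (act x e),
        forall e, Ext psi e <->
          exists Psi : factor_data M,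
            factor_system Psi /\ e = fell_class psi (fs_bundle Psi),
        forall (w : G -> G -> B) (Psi : factor_data M),
          Z2 psi w -> factor_system Psi ->
          factor_system (twist w Psi) /\
          act (H2_class psi w) (fell_class psi (fs_bundle Psi))
          = fell_class psi (fs_bundle (twist w Psi)),
        (forall e, Ext psi e -> act (H2_one psi) e = e) /\
        (forall x y e, H2 psi x -> H2 psi y -> Ext psi e ->
           act (H2_mul x y) e = act x (act y e)) &
        forall e f, Ext psi e -> Ext psi f ->
          exists! x, H2 psi x /\ act x e = f].
Proof.
have psiP := psi_hom.1; have psiM := repr_psi M.
have actE := ext_act_class psiP (M := M).
have twF := twist_factor_system psiP (M := M).
have extP := ExtP psiP M.
exists (ext_act M); split.
- move=> _ e [w Zw <-] /extP[Psi [fP ->]]; rewrite actE//; apply/extP.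
  by exists (twist w Psi); split=> //; exact: twF.
- exact: extP.
- by move=> w Psi Zw fP; split; [exact: twF|exact: actE].
- split=> [e /extP[Psi [fP ->]]|_ _ e [w Zw <-] [v Zv <-] /extP[Psi [fP ->]]].
    by rewrite actE ?twist_one//; exact: (Z2_one psiP psiM).
  rewrite (H2_mul_class psiP psiM)// !actE ?(twist_mul psiP)//.
    exact: twF.
  exact: (Z2_mul psiP psiM).
move=> _ _ /extP[Psi [fP ->]] /extP[Psi' [fP' ->]].
have [w Zw ->] := factor_systems_twist psiP fP fP'.
exists (H2_class psi w); split; first by split; [exists w|exact: actE].
move=> _ [[v Zv <-]]; rewrite actE// => vw.
apply: (H2_class_eq psiP psiM); apply/(fell_equiv_twist psiP Zw Zv fP).
apply/(fell_class_eq (psi := psi)); last exact: esym.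
- exact: fs_fell_over (twF _ _ Zw fP).
- exact: fs_fell_over (twF _ _ Zv fP).
Qed.
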